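(* There is an absolute constant $c$ such that for every integer $d\ge 1$, every projective curve $C\subset\mathbb{P}^2_{\mathbb{Q}}$ of degree $d$ and every real $B\ge 1$ one has $$\#C(\mathbb{Q},B)\le c\,d^{\frac{2}{3}}B^2.$$
   Context: A variety in $\mathbb{P}^n_{\mathbb{Q}}$ is a reduced (closed) subscheme of $\mathbb{P}^n_{\mathbb{Q}}$, not necessarily irreducible; a curve is a variety of pure dimension $1$, and its degree is the sum of the degrees of its irreducible components. $C(\mathbb{Q},B)$ denotes the set of rational points of $C$ of height $\le B$, i.e. the points that can be written in homogeneous integer coordinates $(x_0,\dots,x_n)$ (not all zero) with $|x_0|,\dots,|x_n|\le B$. *)

(* Defs.v *)
From mathcomp Require Import all_boot all_order all_algebra.
From mathcomp Require Import mpoly.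
From mathcomp Require Import classical_sets cardinality reals exp.

Set Implicit Arguments.
Unset Strict Implicit.
Unset Printing Implicit Defensive.

Import Order.TTheory GRing.Theory Num.Theory.

Local Open Scope classical_set_scope.
Local Open Scope ring_scope.

(* Closed subschemes of P^n_Q are handled through homogeneous ideals of the   *)
(* homogeneous coordinate ring S = Q[X_0, ..., X_n], P^n_Q being Proj S.      *)

Definition homogeneous_ideal n (I : set {mpoly rat[n.+1]}) : Prop :=
  [/\ I 0,
      forall p q, I p -> I q -> I (p + q),
      forall p q, I q -> I (p * q) &
      forall p e, I p -> I (pihomog mdeg e p)].

(* Points of Proj S, i.e. integral closed subschemes of P^n_Q: homogeneous    *)
(* primes that do not contain the irrelevant ideal (X_0, ..., X_n).           *)
Definition proj_prime n (P : set {mpoly rat[n.+1]}) : Prop :=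
  [/\ homogeneous_ideal P, ~ P 1,
      forall p q, P (p * q) -> P p \/ P q &
      exists i : 'I_n.+1, ~ P 'X_i].

(* Reduced closed subschemes of P^n_Q, in inclusion-reversing bijection with  *)
(* the homogeneous radical ideals other than the irrelevant ideal itself (the *)
(* empty subscheme being given by S).                                         *)
Definition variety n (I : set {mpoly rat[n.+1]}) : Prop :=
  [/\ homogeneous_ideal I,
      forall p k, I (p ^+ k) -> I p &
      (forall i : 'I_n.+1, I 'X_i) -> I 1].

(* Maximal irreducible closed subsets of V(I) = minimal primes over I.        *)
Definition irreducible_component n (I P : set {mpoly rat[n.+1]}) : Prop :=
  [/\ proj_prime P, I `<=` P &
      forall Q, proj_prime Q -> I `<=` Q -> Q `<=` P -> Q = P].

(* There is a chain Z_0 > Z_1 > ... > Z_r of irreducible closed subsets of    *)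
(* V(I), given by their ideals.                                               *)
Definition dim_ge n (I : set {mpoly rat[n.+1]}) (r : nat) : Prop :=
  exists Q : nat -> set {mpoly rat[n.+1]},
    (forall j, (j <= r)%N -> proj_prime (Q j) /\ I `<=` Q j) /\
    (forall j, (j < r)%N -> Q j `<` Q j.+1).

Definition has_dim n (I : set {mpoly rat[n.+1]}) (r : nat) : Prop :=
  dim_ge I r /\ ~ dim_ge I r.+1.

Definition pure_dim n (I : set {mpoly rat[n.+1]}) (r : nat) : Prop :=
  forall P, irreducible_component I P -> has_dim P r.

Definition curve n (I : set {mpoly rat[n.+1]}) : Prop :=
  variety I /\ pure_dim I 1.

(* dim_Q (S / I)_m = k: some k forms of degree m are a basis modulo I.        *)
Definition hilbert_value n (I : set {mpoly rat[n.+1]}) (m k : nat) : Prop :=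
  exists b : 'I_k -> {mpoly rat[n.+1]},
    [/\ forall i, b i \is m.-homog,
        forall a : 'I_k -> rat, I (\sum_i a i *: b i) -> forall i, a i = 0 &
        forall p, p \is m.-homog ->
          exists a : 'I_k -> rat, I (p - \sum_i a i *: b i)].

Definition hilbert_polynomial n (I : set {mpoly rat[n.+1]}) (h : {poly rat})
    : Prop :=
  exists M : nat, forall m, (M <= m)%N ->
    exists2 k, hilbert_value I m k & h.[m%:R] = k%:R.

(* Degree of an integral closed subscheme of dimension r: r! times the        *)
(* leading coefficient of its Hilbert polynomial, which has degree r.         *)
Definition integral_degree n (P : set {mpoly rat[n.+1]}) (d : nat) : Prop :=
  exists (r : nat) (h : {poly rat}),
    [/\ has_dim P r, hilbert_polynomial P h, size h = r.+1 &
        d%:R = (r`!)%:R * lead_coef h].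

Definition has_degree n (I : set {mpoly rat[n.+1]}) (d : nat) : Prop :=
  exists (k : nat) (P : 'I_k -> set {mpoly rat[n.+1]}) (e : 'I_k -> nat),
    [/\ injective P,
        forall Q, irreducible_component I Q <-> exists i, Q = P i,
        forall i, integral_degree (P i) (e i) &
        d = (\sum_i e i)%N].

(* P^n(Q): the lines through the origin in Q^(n+1).                           *)
Notation rat_proj n := {L : {vspace 'rV[rat]_n.+1} | \dim L == 1%N}.

Definition lies_on n (L : rat_proj n) (I : set {mpoly rat[n.+1]}) : Prop :=
  forall p, I p -> forall v : 'rV[rat]_n.+1, v \in val L -> v != 0 ->
    p.@[fun i => v 0 i] = 0.

Definition height_le (R : realType) n (L : rat_proj n) (B : R) : Prop :=
  exists x : 'rV[int]_n.+1,
    [/\ x != 0, forall i, `|x 0 i|%:~R <= B &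
        val L = <[map_mx (fun z : int => z%:~R : rat) x]>%VS].

Definition rational_points (R : realType) n (I : set {mpoly rat[n.+1]}) (B : R)
    : set (rat_proj n) :=
  [set L | lies_on L I /\ height_le L B].

(* Main.v *)
From HB Require Import structures.
Require Import Defs.
From mathcomp Require Import all_boot all_order all_algebra finmap.
From mathcomp Require Import mpoly.
From mathcomp Require Import boolp classical_sets cardinality reals exp.
From mathcomp Require Import ring lra zify.
Set Implicit Arguments.
Unset Strict Implicit.
Unset Printing Implicit Defensive.
Import Order.TTheory GRing.Theory Num.Theory.
Local Open Scope classical_set_scope.
Local Open Scope ring_scope.

(** The estimate is a weighted count of the rational lines that meet the
    points.  With N the integer part of B, a rational point of height at most
    B is the class of an integer vector x with entries at most N in absolute
    value.  By the pigeonhole principle x is orthogonal to some primitive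
    integer vector a with entries O(N^(1/2)) ([short_orthogonal]), so the
    points are spread over O(N^(3/2)) rational lines a.X = 0.  All points of
    the curve are zeros of one nonzero form F of degree n = 2d
    ([curve_equation]), and the lines are of two kinds.

    - A line on which F does not vanish identically carries at most n + 1
      points ([zeros_on_plane]), hence O(d N^(3/2)) points altogether; this is
      O(d^(2/3) N^2) when d <= N^(3/2), and for larger d the number O(N^3) of
      all vectors x already suffices.
    - At most 2n primitive vectors a give lines inside F = 0
      ([planes_in_zeros]), and such a line carries O(N^2 / |a|) points
      ([points_on_plane]).  As only O(j^3) vectors have |a| <= j, the sum of
      1 / |a| over O(d) vectors is largest when they fill the ball of radius
      d^(1/3), where it is O(d^(2/3)) ([sum_inv_ht]).

    The form F is a product over the components of the curve.  Let P be the
    prime of a component of degree e, so that its Hilbert function grows by e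
    at each large degree.  A form of degree 2e in P is found by counting, with
    no appeal to unique factorization ([low_degree_form]): choose linear forms
    u, w without common zero on the component.  To vanish to order N = 2e + 1
    along w = 0 on the component imposes at most eN linear conditions, fewer
    than the dimension (2e + 1)(e + 1) of the forms of degree 2e; and a form of
    degree 2e < N which does so has more zeros than the component allows,
    unless it belongs to P.  A rational point of the curve lies on one of the
    components because its ideal contains a minimal prime over the ideal of the
    curve ([minimal_prime], by Zorn's lemma). *)

(** * Values of forms along lines *)

Lemma meval_homogZ k n (F : {mpoly rat[k]}) (c : rat) (v : 'rV[rat]_k) :
  F \is n.-homog ->
  F.@[fun i => (c *: v) 0 i] = c ^+ n * F.@[fun i => v 0 i].
Proof.
move=> /dhomogP homF; rewrite !mevalE mulr_sumr big_seq [RHS]big_seq.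
apply: eq_bigr => m /homF /= <-; rewrite mulrCA mdegE; congr (_ * _).
rewrite -prodrXr -big_split /=; apply: eq_bigr => i _.
by rewrite mxE exprMn.
Qed.

Definition line_poly (F : {mpoly rat[3]}) (p w : 'rV[rat]_3) : {poly rat} :=
  \sum_(m <- msupp F) F@_m *: \prod_i ((p 0 i)%:P + w 0 i *: 'X) ^+ m i.

Lemma horner_line_poly F p w U :
  (line_poly F p w).[U] = F.@[fun i => (p + U *: w) 0 i].
Proof.
rewrite /line_poly horner_sum mevalE; apply: eq_bigr => m _.
rewrite hornerZ horner_prod; congr (_ * _); apply: eq_bigr => i _.
by rewrite horner_exp !hornerE !mxE [U * _]mulrC.
Qed.

Lemma size_line_poly n F p w :
  F \is n.-homog -> (size (line_poly F p w) <= n.+1)%N.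
Proof.
move=> /dhomogP homF; rewrite /line_poly big_seq.
apply: (leq_trans (size_sum _ _ _)); apply/bigmax_leqP_seq => m mF _.
apply: leq_trans (size_scale_leq _ _) _.
apply: leq_trans (size_prod_leq _ _) _.
rewrite -(homF m mF) /= mdegE cardT size_enum_ord leq_subLR.
rewrite addnS ltnS -[X in (_ <= X + _)%N](card_ord 3) -sum1_card -big_split /=.
apply: leq_sum => i _; apply: leq_trans (size_poly_exp_leq _ _) _.
rewrite add1n ltnS -[leqRHS]mul1n leq_mul2r; apply/orP; right.
rewrite -subn1 leq_subLR; apply: leq_trans (size_polyD _ _) _.
rewrite geq_max (leq_trans (size_polyC_leq1 _)) //=.
by rewrite (leq_trans (size_scale_leq _ _)) // size_polyX.
Qed.

(** U = 0 is not a root, so the restriction of F to the line is a nonzero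
    polynomial of degree at most n: starting from a point p that is not a zero
    replaces any condition on the leading coefficient. *)
Lemma zeros_on_line n F (p w : 'rV[rat]_3) (s : seq rat) :
    F \is n.-homog -> F.@[fun i => (p : 'rV_3) 0 i] != 0 -> uniq s ->
    {in s, forall U, F.@[fun i => (p + U *: w) 0 i] = 0} ->
  (size s <= n)%N.
Proof.
move=> homF Fp us sF; rewrite -ltnS.
apply: leq_trans (size_line_poly p w homF).
apply: max_poly_roots => //; last first.
  by apply/allP => U /sF FU; rewrite /root horner_line_poly FU.
apply: contraNneq Fp => l0.
by rewrite -[p]addr0 -(scale0r w) -horner_line_poly l0 horner0.
Qed.

Lemma exists_nonroot (f : {poly rat}) : f != 0 -> exists t, f.[t] != 0.
Proof.
move=> f0; pose s : seq rat := [seq i%:R | i <- iota 0 (size f)].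
have us : uniq s.
  rewrite map_inj_uniq ?iota_uniq // => i j /eqP.
  by rewrite eqr_nat => /eqP.
have /allPn[t _ ft] : ~~ all (root f) s.
  by apply/negP => /(max_poly_roots f0) /(_ us); rewrite size_map size_iota ltnn.
by exists t.
Qed.

Lemma muni_eq0 n (p : {mpoly rat[n.+1]}) : (muni p == 0) = (p == 0).
Proof.
apply/eqP/eqP => [p0|->]; last by rewrite raddf0.
apply/mpolyP => m; rewrite mcoeff0.
have := congr1 (fun q : {poly {mpoly rat[n]}} =>
  q`_(m ord_max)@_[multinom m (widen_ord (leqnSn n) i) | i < n]) p0.
rewrite coef0 mcoeff0 muniE coef_sum raddf_sum /=.
case: (boolP (m \in msupp p)) => [mp | /memN_msupp_eq0 //].
rewrite (bigD1_seq m) ?msupp_uniq //= big1 ?addr0.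
  by rewrite !coefZ coefXn eqxx mulr1 mcoeffZ mcoeffX eqxx mulr1.
move=> m' ne_m'; rewrite !coefZ coefXn.
case: eqP => [em|_]; last by rewrite mulr0 mcoeff0.
rewrite mulr1 mcoeffZ mcoeffX; case: eqP => [e|_]; last by rewrite mulr0.
case/eqP: ne_m'; apply/mnmP => i.
case: (unliftP ord_max i) => [j ->|->]; last by rewrite em.
have -> : lift ord_max j = widen_ord (leqnSn n) j.
  by apply: val_inj; rewrite /= /bump leqNgt ltn_ord.
by have /mnmP/(_ j) := e; rewrite !mnmE.
Qed.

Lemma horner_muni n (p : {mpoly rat[n.+1]}) (v : 'I_n -> rat) t :
  (map_poly (meval v) (muni p)).[t] =
  p.@[fun i => if unlift ord_max i is Some j then v j else t].
Proof.
rewrite muniE raddf_sum horner_sum mevalE; apply: eq_bigr => m _ /=.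
rewrite map_polyZ map_polyXn hornerZ hornerXn [X in X * _]mevalZ -mulrA.
congr (_ * _).
rewrite mevalX big_ord_recr /= unlift_none; congr (_ * _).
apply: eq_bigr => i _; rewrite mnmE.
have -> : widen_ord (leqnSn n) i = lift ord_max i.
  by apply: val_inj; rewrite /= /bump leqNgt ltn_ord.
by rewrite liftK.
Qed.

(** Induction on the number of variables: values of the other variables at
    which the leading coefficient in the last one does not vanish leave a
    nonzero polynomial in one variable. *)
Lemma exists_nonzero n (p : {mpoly rat[n]}) :
  p != 0 -> exists v : 'I_n -> rat, p.@[v] != 0.
Proof.
elim: n p => [|n IHn] p p0.
  have ep : p = (p@_0%MM)%:MP.
    apply/mpolyP => m; have -> : m = 0%MM by apply/mnmP; case.
    by rewrite mcoeffC eqxx mulr1.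
  exists (fun=> 0); rewrite ep mevalC.
  by apply: contraNneq p0 => c0; rewrite ep c0 mpolyC0.
have /IHn[v pv] : lead_coef (muni p) != 0 by rewrite lead_coef_eq0 muni_eq0.
have /exists_nonroot[t pt] : map_poly (meval v) (muni p) != 0.
  apply: contraNneq pv => q0; rewrite lead_coefE.
  by have /polyP/(_ (size (muni p)).-1) := q0; rewrite coef_map coef0 => ->.
by rewrite horner_muni in pt; eexists; exact: pt.
Qed.

(** * Integer vectors *)

Lemma ord3 (i : 'I_3) : i = 0 \/ i = 1 \/ i = 2.
Proof.
by case: i => [[|[|[|//]]] hi]; [left|right; left|right; right]; exact: val_inj.
Qed.

Definition dot (A : comNzRingType) (u v : 'rV[A]_3) : A :=
  \sum_i u 0 i * v 0 i.

Definition toQ (x : 'rV[int]_3) : 'rV[rat]_3 :=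
  map_mx (fun z : int => z%:~R : rat) x.

Lemma dot_toQ a x : dot (toQ a) (toQ x) = (dot a x)%:~R.
Proof.
by rewrite /dot rmorph_sum; apply: eq_bigr => i _; rewrite !mxE rmorphM.
Qed.

Lemma dotC (A : comNzRingType) (u v : 'rV[A]_3) : dot u v = dot v u.
Proof. by apply: eq_bigr => i _; rewrite mulrC. Qed.

Lemma dotDr (A : comNzRingType) (u v w : 'rV[A]_3) :
  dot u (v + w) = dot u v + dot u w.
Proof. by rewrite -big_split; apply: eq_bigr => i _; rewrite mxE mulrDr. Qed.

Lemma dotZr (A : comNzRingType) c (u v : 'rV[A]_3) :
  dot u (c *: v) = c * dot u v.
Proof. by rewrite mulr_sumr; apply: eq_bigr => i _; rewrite mxE mulrCA. Qed.

Lemma toQ_eq0 x : (toQ x == 0) = (x == 0).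
Proof.
apply/eqP/eqP => [/rowP x0|->]; last by apply/rowP => i; rewrite !mxE.
by apply/rowP => i; have /eqP := x0 i; rewrite !mxE intr_eq0 => /eqP.
Qed.

Definition ht (a : 'rV[int]_3) : nat := (\max_i absz (a 0%R i))%N.

Lemma ht_leP (a : 'rV[int]_3) K :
  reflect (forall i, (absz (a 0 i)%R <= K)%N) (ht a <= K)%N.
Proof.
apply: (iffP (bigmax_leqP _ _ _)) => h i; first exact: h.
by move=> _; exact: h.
Qed.

Lemma ht_eq0 a : (ht a == 0)%N = (a == 0).
Proof.
apply/idP/eqP => [|->]; first rewrite -leqn0 => /ht_leP h.
  apply/rowP => i; move: (h i); rewrite leqn0 absz_eq0 => /eqP ->.
  by rewrite mxE.
by rewrite -leqn0; apply/ht_leP => i; rewrite mxE.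
Qed.

Definition box_code (K : nat) (f : {ffun 'I_3 -> 'I_(2 * K).+1}) : 'rV[int]_3 :=
  \row_i ((f i)%:Z - K%:Z).

Definition box K : seq 'rV[int]_3 :=
  [seq box_code f | f : {ffun 'I_3 -> 'I_(2 * K).+1}].

Lemma size_box K : size (box K) = ((2 * K).+1 ^ 3)%N.
Proof. by rewrite size_map -cardE card_ffun !card_ord. Qed.

Lemma mem_box K (a : 'rV[int]_3) : (a \in box K) = (ht a <= K)%N.
Proof.
apply/mapP/ht_leP => [[f _ ->] i|h].
  rewrite mxE; move: (ltn_ord (f i)); move: (nat_of_ord (f i)) => z; clear; lia.
exists [ffun i => inord (absz (a 0 i + K%:Z)%R)]; first by rewrite mem_enum.
apply/rowP => i; rewrite mxE ffunE.
by rewrite inordK; move: (h i); move: (a 0 i) => z; clear; lia.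
Qed.

Lemma size_le_box (s : seq 'rV[int]_3) K :
  uniq s -> {in s, forall a, (ht a <= K)%N} -> (size s <= (2 * K).+1 ^ 3)%N.
Proof.
move=> us sK; rewrite -size_box; apply: uniq_leq_size => // a /sK.
by rewrite mem_box.
Qed.

(** A Bezout relation is used in place of gcd = 1 because each argument below
    needs the vector u itself. *)
Definition primitive (a : 'rV[int]_3) := exists u, dot a u = 1.

Lemma bezout3 (x : 'rV[int]_3) :
  exists u, forall i, (dot x u %| x 0%R i)%Z.
Proof.
have [u0 [v0 h0]] := Bezoutz (x 0 0) (x 0 1).
have [u1 [v1 h1]] := Bezoutz (gcdz (x 0 0) (x 0 1)) (x 0 (inord 2)).
have e2 : inord 2 = 2 :> 'I_3 by apply: val_inj; rewrite /= inordK.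
rewrite e2 in h1.
exists (\row_i nth 0 [:: u1 * u0; u1 * v0; v1] i).
set d := dot _ _.
have -> : d = gcdz (gcdz (x 0 0) (x 0 1)) (x 0 2).
  rewrite -h1 -h0 /d /dot !big_ord_recl big_ord0 !mxE /=.
  rewrite (_ : lift ord0 ord0 = 1) 1?(_ : lift ord0 (lift ord0 ord0) = 2).
    by ring.
  1,2: exact: val_inj.
move=> i; case: (ord3 i) => [->|[->|->]].
- by apply: dvdz_trans (dvdz_gcdl _ _) (dvdz_gcdl _ _).
- by apply: dvdz_trans (dvdz_gcdl _ _) (dvdz_gcdr _ _).
- exact: dvdz_gcdr.
Qed.

Lemma primitive_part (a : 'rV[int]_3) : a != 0 ->
  exists2 b, primitive b & exists2 g : int, g != 0 & a = g *: b.
Proof.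
move=> a0; have [u hu] := bezout3 a; set g := dot a u in hu.
have g0 : g != 0.
  apply: contraNneq a0 => g0; apply/eqP/rowP => i.
  by have := hu i; rewrite g0 dvd0z mxE => /eqP.
pose b : 'rV[int]_3 := \row_i (a 0%R i %/ g)%Z.
have ab : a = g *: b.
  by apply/rowP => i; rewrite !mxE mulrC divzK.
exists b; last by exists g.
exists u; apply: (mulfI g0).
by rewrite mulr1 dotC -dotZr -ab dotC.
Qed.

Lemma primitive_neq0 a : primitive a -> a != 0.
Proof.
case=> u au; apply/eqP => a0; move: au; rewrite a0 dotC -(scale0r u) dotZr.
by rewrite mul0r => /esym/eqP; rewrite oner_eq0.
Qed.

(** Bezout vectors for a and b turn the vanishing minors into a = s b and
    b = t a with integers s and t, whence s t = 1. *)
Lemma primitive_proportional a b : primitive a -> primitive b ->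
  (forall i j, a 0 i * b 0 j = a 0 j * b 0 i) -> a = b \/ a = - b.
Proof.
move=> pa pb; have a0 := primitive_neq0 pa.
case: pa pb => [u au] [v bv] ab.
have e1 : a = dot a v *: b.
  apply/rowP => i; rewrite mxE -[LHS]mulr1 -bv mulr_sumr mulr_suml.
  by apply: eq_bigr => j _; rewrite mulrA ab mulrAC.
have e2 : b = dot b u *: a.
  apply/rowP => i; rewrite mxE -[LHS]mulr1 -au mulr_sumr mulr_suml.
  by apply: eq_bigr => j _; rewrite mulrA [b 0 i * _]mulrC -ab -mulrA mulrC.
have : dot a v * dot b u = 1.
  have [i ai] : exists i, a 0 i != 0.
    by apply/existsP; rewrite -negb_forall; apply: contra a0 => /forallP h;
      apply/eqP/rowP => i; rewrite mxE; exact/eqP.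
  apply: (mulIf ai); rewrite mul1r.
  by have /rowP/(_ i) := e1; rewrite {1}e2 !mxE mulrA => <-.
set s := dot a v in e1 *; set t := dot b u => st.
have : absz s = 1%N.
  by have := congr1 absz st; rewrite abszM /= => /eqP; rewrite muln_eq1 => /andP[/eqP].
rewrite e1; case: (s) => [[|[|//]]|[|//]] // _; [left|right].
  by rewrite scale1r.
by rewrite scaleN1r.
Qed.

(** * Integer points on a rational line *)

(** A packing argument.  Let h = ht a be attained at the coordinate k, and let
    dot a u = 1.  For x in s and 0 <= j < h take x + j u, without its coordinate
    k and with the coordinates of j u reduced modulo h.  Since h divides a_k,
    its product with the remaining coordinates of a is j modulo h; so it
    determines j, then the coordinates of x other than k, and then x.  All these
    size s * h pairs of integers lie in a square with 2N + h values on a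
    side. *)
Lemma points_on_plane (a : 'rV[int]_3) (s : seq 'rV[int]_3) N :
    primitive a -> uniq s ->
    {in s, forall x, dot a x = 0 /\ (ht x <= N)%N} ->
  (size s * ht a <= (2 * N + ht a).+1 ^ 2)%N.
Proof.
move=> pa us sP; have a0 := primitive_neq0 pa.
have [k hk] : {k | ht a = absz (a 0 k)} by apply: bigop.eq_bigmax; rewrite card_ord.
have := a0; rewrite -ht_eq0 -lt0n.
move: (ht a) hk => h hk h0; have {pa}[u au] := pa.
have ak0 : a 0 k != 0 by rewrite -absz_eq0 -hk -lt0n.
have hak : (h%:Z %| a 0%R k)%Z by rewrite dvdzE hk.
have hz : 0 < h%:Z by rewrite ltz_nat.
have hz0 : h%:Z != 0 by rewrite eqz_nat -lt0n.
pose y (x : 'rV[int]_3) (j : nat) i :=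
  x 0 (lift k i) + ((j%:Z * u 0%R (lift k i)) %% h%:Z)%Z.
have dotE (v : 'rV[int]_3) :
    dot a v = a 0 k * v 0 k + \sum_i a 0 (lift k i) * v 0 (lift k i).
  by rewrite /dot (bigD1_ord k).
(* the coordinate k contributes a multiple of h to the products with a *)
have yj x j : dot a x = 0 ->
    (h%:Z %| \sum_i a 0%R (lift k i) * y x j i - j%:Z)%Z.
  move=> ax.
  have -> : \sum_i a 0 (lift k i) * y x j i - j%:Z = - (a 0 k * x 0 k)
     - j%:Z * (a 0 k * u 0 k)
     - (\sum_i a 0 (lift k i) * ((j%:Z * u 0%R (lift k i)) %/ h%:Z)%Z) * h%:Z.
    have -> : - (a 0 k * x 0 k) = \sum_i a 0 (lift k i) * x 0 (lift k i).
      by apply/esym/eqP; rewrite -addr_eq0 addrC -dotE ax.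
    have -> : j%:Z * (a 0 k * u 0 k) =
        j%:Z - \sum_i a 0 (lift k i) * (j%:Z * u 0 (lift k i)).
      rewrite -[X in X - _]mulr1 -au dotE mulrDr [X in _ + X - _]mulr_sumr.
      rewrite -addrA -sumrB big1 ?addr0 // => i _.
      by rewrite mulrCA subrr.
    rewrite opprB [in RHS]addrA [RHS]addrAC; congr (_ - _).
    rewrite mulr_suml -big_split -sumrB; apply: eq_bigr => i _ /=.
    rewrite /y; move: (divz_eq (j%:Z * u 0 (lift k i)) h%:Z).
    by move: (_ %/ _)%Z (_ %% _)%Z => q r ->; ring.
  apply: rpredB; last exact: dvdz_mull.
  by apply: rpredB; rewrite ?rpredN; [|apply: dvdz_mull]; apply: dvdz_mulr.
pose code (xj : 'rV[int]_3 * 'I_h) : {ffun 'I_2 -> 'I_(2 * N + h).+1} :=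
  [ffun i => inord (absz (y xj.1 xj.2 i + N%:Z))].
have inj : {in [seq (x, j) | x <- s, j <- enum 'I_h] &, injective code}.
  move=> [x j] [x' j'] /allpairsP[[x1 j1] [/= x1s _ [-> ->]]].
  move=> /allpairsP[[x2 j2] [/= x2s _ [-> ->]]] {x j x' j'} /ffunP e.
  have [[ax1 /ht_leP b1] [ax2 /ht_leP b2]] := (sP _ x1s, sP _ x2s).
  have {}e i : y x1 j1 i = y x2 j2 i.
    have := e i; rewrite !ffunE /= => /(congr1 (@nat_of_ord _)).
    have := b1 (lift k i); have := b2 (lift k i); rewrite /y.
    have := ltz_pmod (j1%:Z * u 0%R (lift k i)) hz.
    have := ltz_pmod (j2%:Z * u 0%R (lift k i)) hz.
    have := modz_ge0 (j1%:Z * u 0%R (lift k i)) hz0.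
    have := modz_ge0 (j2%:Z * u 0%R (lift k i)) hz0.
    move: (x1 _ _) (x2 _ _) (_ %% _)%Z (_ %% _)%Z; clear => r1 r2 z1 z2.
    move=> g1 g2 g3 g4 g5 g6; rewrite !inordK; lia.
  have jj : j1 = j2.
    apply: val_inj => /=.
    have d1 := yj _ j1 ax1; have d2 := yj _ j2 ax2.
    have ee : \sum_i a 0 (lift k i) * y x1 j1 i =
              \sum_i a 0 (lift k i) * y x2 j2 i.
      by apply: eq_bigr => i _; rewrite e.
    rewrite ee in d1; move: d1 d2; move: (\sum_i _) => S d1 d2.
    have : (h%:Z %| j1%:Z - j2%:Z)%Z.
      have -> : j1%:Z - j2%:Z = (S - j2%:Z) - (S - j1%:Z) by ring.
      exact: rpredB.
    by rewrite -eqz_mod_dvd !modz_nat !modn_small // => /eqP[].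
  congr (_, _) => //; subst j2.
  apply/rowP => i.
  have ex i' : x1 0 (lift k i') = x2 0 (lift k i').
    by have := e i'; rewrite /y => /addIr.
  case: (unliftP k i) => [i' -> // | ->]; apply: (mulfI ak0).
  have := ax1; rewrite -ax2 !dotE.
  under eq_bigr do rewrite ex.
  exact: addIr.
have := uniq_leq_size (s1 := map code [seq (x, j) | x <- s, j <- enum 'I_h])
  (s2 := enum {ffun 'I_2 -> 'I_(2 * N + h).+1}).
rewrite map_inj_in_uniq // size_map size_allpairs -!cardE card_ffun !card_ord.
apply.
  by apply: allpairs_uniq => //; [exact: enum_uniq | move=> [? ?] [? ?] ].
by move=> ? _; rewrite mem_enum.
Qed.

(** Siegel's lemma: the products with x of the (K + 1)^3 vectors with entries
    in 0, ..., K lie in an interval of length 6NK, so two of these vectors have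
    the same product, and their difference is orthogonal to x. *)
Lemma short_orthogonal (x : 'rV[int]_3) N K :
  (0 < N)%N -> (ht x <= N)%N -> (6 * N <= K.+1 ^ 2)%N ->
  exists a, [/\ primitive a, dot a x = 0 & (ht a <= K)%N].
Proof.
move=> N0 /ht_leP xN NK.
pose vec (f : {ffun 'I_3 -> 'I_K.+1}) : 'rV[int]_3 := \row_i (f i)%:Z.
have bound f : `|dot (vec f) x| <= (3 * (N * K))%:Z.
  apply: le_trans (ler_norm_sum _ _ _) _.
  apply: (@le_trans _ _ (\sum_(i < 3) (N * K)%:Z)).
    apply: ler_sum => i _; rewrite mxE normrM.
    have := xN i; have := ltn_ord (f i).
    move: (nat_of_ord _) (x _ _); clear => m z; nia.
  by rewrite sumr_const card_ord; lia.
pose code f : 'I_(6 * (N * K)).+1 := inord (absz (dot (vec f) x + (3 * (N * K))%:Z)).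
have : ~~ injectiveb code.
  apply/negP => /injectiveP /leq_card.
  rewrite card_ffun !card_ord; apply/negP; rewrite -ltnNge.
  move: NK N0; clear; rewrite !expnS expn0; nia.
case/injectivePn => f [g fg] /(congr1 (@nat_of_ord _)).
have bf := bound f; have bg := bound g.
rewrite !inordK; [|lia|lia] => e.
have {e} e : dot (vec f) x = dot (vec g) x by lia.
have ab0 : vec f - vec g != 0.
  apply: contraNneq fg => /eqP; rewrite subr_eq0 => /eqP/rowP h.
  by apply/eqP/ffunP => i; have := h i; rewrite !mxE => -[] /val_inj.
have [a pa [t t0 at_]] := primitive_part ab0; exists a; split=> //.
  apply: (mulfI t0); rewrite mulr0 dotC -dotZr -at_ dotDr -scaleN1r.
  by rewrite dotZr !(dotC x) e mulN1r subrr.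
apply/ht_leP => i.
have : (absz (a 0%R i) <= absz ((vec f - vec g)%R 0%R i))%N.
  by rewrite at_ mxE abszM leq_pmull // absz_gt0.
rewrite !mxE; move: (ltn_ord (f i)) (ltn_ord (g i)).
move: (nat_of_ord _) (nat_of_ord _) (a 0 i); clear; lia.
Qed.

(** * Rational lines and the zeros of a form *)

Lemma vline_scale (c : rat) (v : 'rV[rat]_3) : c != 0 -> (<[c *: v]> = <[v]>)%VS.
Proof.
move=> c0; apply/eqP; rewrite eqEsubv -!memvE memvZ ?memv_line //=.
by rewrite -{1}[v]scale1r -(mulVf c0) -scalerA memvZ // memv_line.
Qed.

(** The matrix with rows x, y, z annihilates the nonzero vector a. *)
Lemma coplanar (a x y z : 'rV[rat]_3) : a != 0 -> dot a x = 0 -> dot a y = 0 ->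
  dot a z = 0 -> exists c : rat * rat * rat,
    c != 0 /\ c.1.1 *: x + c.1.2 *: y + c.2 *: z = 0.
Proof.
move=> a0 ax ay az.
pose M := \matrix_(i < 3) nth 0 [:: x; y; z] i.
have aM : a *m M^T = 0.
  apply/rowP => i; rewrite !mxE.
  transitivity (dot a (nth 0 [:: x; y; z] i)).
    by apply: eq_bigr => j _; rewrite !mxE.
  by case: i => [[|[|[|//]]] ?].
have /det0P[c c0 cM] : \det M == 0.
  by rewrite -det_tr; apply/det0P; exists a.
exists (c 0 0, c 0 1, c 0 2); split.
  apply: contraNneq c0 => -[c00 c01 c02]; apply/eqP/rowP => i; rewrite mxE.
  by case: (ord3 i) => [->|[->|->]].
rewrite -[RHS]cM mulmx_sum_row !big_ord_recl big_ord0 !rowK /= addr0 addrA.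
rewrite (_ : lift ord0 ord0 = 1) 1?(_ : lift ord0 (lift ord0 ord0) = 2) //.
all: exact: val_inj.
Qed.

(** Let z be the first zero.  Any other zero x is a multiple of p + U z for
    some U, because p, z and x are coplanar and neither is x proportional to z
    nor p a zero.  Different zeros have different U, and these U are zeros of F
    along the line through p with direction z. *)
Lemma zeros_on_plane n F (a p : 'rV[rat]_3) (s : seq 'rV[rat]_3) :
    F \is n.-homog -> a != 0 -> dot a p = 0 -> F.@[fun i => p 0 i] != 0 ->
    {in s, forall x, [/\ x != 0, dot a x = 0 & F.@[fun i => x 0 i] = 0]} ->
    uniq [seq <[x]>%VS | x <- s] ->
  (size s <= n.+1)%N.
Proof.
move=> homF a0 ap Fp; case: s => [//|z s] sP /=.
have [z0 az Fz] := sP z (mem_head _ _).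
case/andP => zs us; rewrite ltnS.
have /choice[f fP] : forall x, exists U, x \in s ->
    F.@[fun i => (p + U *: z) 0 i] = 0 /\ (<[x]> = <[p + U *: z]>)%VS.
  move=> x; case: (boolP (x \in s)) => [xs|]; last by exists 0.
  have [x0 ax Fx] := sP x (mem_behead (xs : x \in behead (z :: s))).
  have [[[c d] e] /= [cde0 cde]] := coplanar a0 ax ap az.
  have c0 : c != 0.
    apply: contraNneq Fp => c0; move: cde cde0.
    rewrite c0 scale0r add0r; case: (eqVneq d 0) => [->|d0].
      rewrite scale0r add0r => /eqP; rewrite scaler_eq0 (negPf z0) orbF.
      by move=> /eqP ->; rewrite eqxx.
    move=> /eqP; rewrite addr_eq0 => /eqP dp _.
    have -> : p = (- (d^-1 * e)) *: z.
      by rewrite scaleNr -scalerA -scalerN -dp scalerA mulVf ?scale1r.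
    by rewrite (meval_homogZ _ _ homF) Fz mulr0.
  have d0 : d != 0.
    apply: contraNneq zs => d0; apply/mapP; exists x => //.
    move: cde; rewrite d0 scale0r addr0 => /eqP; rewrite addr_eq0 => /eqP cx.
    have e0 : e != 0.
      apply: contraNneq x0 => e0; move/eqP: cx.
      by rewrite e0 scale0r oppr0 scaler_eq0 (negPf c0).
    by rewrite -(vline_scale x c0) cx -scaleNr vline_scale // oppr_eq0.
  exists (d^-1 * e) => _.
  have xE : <[x]>%VS = <[p + (d^-1 * e) *: z]>%VS.
    rewrite -(vline_scale x c0) -[RHS](vline_scale _ d0) scalerDr scalerA mulrA.
    rewrite divff // mul1r -[RHS](@vline_scale (-1)) ?oppr_eq0 ?oner_eq0 //.
    congr <[_]>%VS; rewrite scaleN1r; apply/eqP; rewrite -addr_eq0 addrA.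
    exact/eqP.
  split=> //; have : p + (d^-1 * e) *: z \in <[x]>%VS by rewrite xE memv_line.
  by case/vlineP => t ->; rewrite (meval_homogZ _ _ homF) Fx mulr0.
rewrite -(size_map f); apply: (zeros_on_line (p := p) (w := z) homF Fp).
  apply: (@map_uniq _ _ (fun U => <[p + U *: z]>%VS)); rewrite -map_comp.
  congr (uniq _): us; apply/eq_in_map => x xs /=.
  by case: (fP x xs).
by move=> _ /mapP[x xs ->]; case: (fP x xs).
Qed.

Definition linform (c : 'rV[rat]_3) : {mpoly rat[3]} := \sum_i c 0 i *: 'X_i.

Lemma meval_linform c (v : 'rV[rat]_3) :
  (linform c).@[fun i => v 0 i] = dot c v.
Proof.
by rewrite /linform raddf_sum; apply: eq_bigr => i _ /=; rewrite mevalZ mevalXU.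
Qed.

Lemma linform_neq0 c : c != 0 -> linform c != 0.
Proof.
apply: contraNneq => c0; apply/eqP/rowP => i; rewrite mxE.
have := congr1 (mcoeff U_(i)) c0; rewrite mcoeff0 raddf_sum /= (bigD1 i) //=.
rewrite mcoeffZ mcoeffX eqxx mulr1 big1 ?addr0 // => j ji.
by rewrite mcoeffZ mcoeffX eq_mnm1 (negPf ji) mulr0.
Qed.

(** The product of the linear forms with coefficients in s is a nonzero
    polynomial. *)
Lemma generic_vector (s : seq 'rV[rat]_3) :
  {in s, forall c, c != 0} -> exists w, {in s, forall c, dot c w != 0}.
Proof.
move=> s0; have /exists_nonzero[v] : \prod_(c <- s) linform c != 0.
  by rewrite prodf_seq_neq0; apply/allP => c /s0 /linform_neq0.
rewrite rmorph_prod /= prodf_seq_neq0 => /allP h.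
exists (\row_i v i) => c /h /=; rewrite -meval_linform.
by congr (_ != 0); apply: meval_eq => i; rewrite mxE.
Qed.

(** Cut the planes with a line p + U w through a point p at which F does not
    vanish.  The plane orthogonal to a is met at U = - (a.p) / (a.w), which is a
    zero of F along the line.  For generic w two planes share this value only if
    they coincide, that is, if their primitive vectors are equal or opposite;
    the sign of a.p separates these two cases, whence the factor 2. *)
Lemma planes_in_zeros n F (L : seq 'rV[int]_3) :
    F \is n.-homog -> F != 0 -> uniq L ->
    {in L, forall a, primitive a /\
       forall v, dot (toQ a) v = 0 -> F.@[fun i => v 0 i] = 0} ->
  (size L <= 2 * n)%N.
Proof.
move=> homF F0 uL LP.
have [p Fp] : exists p : 'rV[rat]_3, F.@[fun i => p 0 i] != 0.
  have [v Fv] := exists_nonzero F0; exists (\row_i v i).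
  by apply: contraNneq Fv => <-; apply/eqP/meval_eq => i; rewrite mxE.
have ap0 a : a \in L -> dot (toQ a) p != 0.
  by move=> /LP[_ aF]; apply: contraNneq Fp => /aF ->.
(* c a b is orthogonal to w exactly when a and b meet the line at the same U *)
pose c (a b : 'rV[int]_3) := dot (toQ a) p *: toQ b - dot (toQ b) p *: toQ a.
have [w wP] : exists w, {in [seq toQ a | a <- L] ++
    [seq c0 <- [seq c a b | a <- L, b <- L] | c0 != 0],
    forall c0, dot c0 w != 0}.
  apply: generic_vector => x; rewrite mem_cat mem_filter.
  case/orP=> [/mapP[a aL ->] | /andP[] //].
  by rewrite toQ_eq0 primitive_neq0 //; case: (LP a aL).
have aw a : a \in L -> dot (toQ a) w != 0.
  by move=> aL; apply: wP; rewrite mem_cat map_f.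
have cw a b : a \in L -> b \in L -> dot (c a b) w = 0 -> c a b = 0.
  move=> aL bL; apply: contra_eq => c0; apply: wP.
  by rewrite mem_cat mem_filter c0 allpairs_f ?orbT.
pose f (a : 'rV[int]_3) := - (dot (toQ a) p / dot (toQ a) w).
have fF a : a \in L -> F.@[fun i => (p + f a *: w) 0 i] = 0.
  move=> aL; case: (LP a aL) => _; apply.
  by rewrite dotDr dotZr mulNr divfK ?subrr ?aw.
have finj a b : a \in L -> b \in L -> f a = f b -> a = b \/ a = - b.
  move=> aL bL /oppr_inj /eqP; rewrite eqr_div ?aw // => /eqP e.
  have /rowP cab : c a b = 0.
    apply: cw => //; rewrite dotC dotDr -scaleN1r !dotZr !(dotC w) mulN1r e.
    by rewrite mulrC subrr.
  have [[pa _] [pb _]] := (LP a aL, LP b bL).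
  apply: primitive_proportional => // i j.
  have ij k : dot (toQ a) p * (b 0 k)%:~R = dot (toQ b) p * (a 0 k)%:~R.
    by have := cab k; rewrite !mxE => /eqP; rewrite subr_eq0 => /eqP.
  apply: (@intr_inj rat); apply: (mulfI (ap0 a aL)); rewrite !rmorphM /=.
  rewrite [LHS]mulrCA [RHS]mulrCA !ij. by ring.
have half (P : pred 'rV[int]_3) :
    (forall a, P a -> P (- a) -> False) -> (count P L <= n)%N.
  move=> PN; rewrite -size_filter -(size_map f).
  apply: (zeros_on_line (p := p) (w := w) homF Fp).
    rewrite map_inj_in_uniq ?filter_uniq // => a b.
    rewrite !mem_filter => /andP[Pa aL] /andP[Pb bL] /(finj a b aL bL)[//|e].
    by case: (PN b Pb); rewrite -e.
  by move=> _ /mapP[a + ->]; rewrite mem_filter => /andP[_ /fF].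
pose P (a : 'rV[int]_3) := 0 < dot (toQ a) p.
have dotN a : dot (toQ (- a)) p = - dot (toQ a) p.
  rewrite ![dot _ p]dotC -mulN1r -dotZr; congr (dot _ _).
  by apply/rowP => i; rewrite !mxE rmorphN mulN1r.
rewrite mul2n -addnn -(count_predC P) leq_add //.
  by apply: half => a; rewrite /P dotN oppr_gt0 => /lt_trans h /h; rewrite ltxx.
have -> : count (predC P) L = count (fun a => dot (toQ a) p < 0) L.
  apply: eq_in_count => a /ap0 a0; rewrite /P /= -leNgt lt_neqAle a0.
  by [].
by apply: half => a; rewrite dotN oppr_lt0 => /lt_trans h /h; rewrite ltxx.
Qed.

(** * Counting the zeros of a form *)

(** For h <= D the sum of 1 / j - 1 / (j + 1) telescopes, with equality. *)
Lemma inv_le_telescope (h D : nat) : (0 < h)%N -> (0 < D)%N ->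
  h%:R^-1 <= D%:R^-1 + \sum_(1 <= j < D | (h <= j)%N) (j%:R * j.+1%:R)^-1 :> rat.
Proof.
move=> h0; elim: D => [//|[|D] IH] _.
  rewrite big_geq // addr0 invr1 invf_le1 ?ltr0n // ler1n //.
rewrite big_mkcond big_nat_recr //= -big_mkcond /=.
case: leqP => hD.
  apply: le_trans (IH isT) _; rewrite [X in _ <= _ + X]addrC addrA lerD2r.
  rewrite le_eqVlt; apply/orP; left; apply/eqP.
  have D1 : D.+1%:R != 0 :> rat by rewrite pnatr_eq0.
  have D2 : D.+2%:R != 0 :> rat by rewrite pnatr_eq0.
  have e : D.+2%:R = D.+1%:R + 1 :> rat by rewrite natr1.
  rewrite e in D2 *; move: (D.+1%:R) D1 D2 => x x0 x1.
  by field; rewrite ?x0 ?x1.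
rewrite addr0; apply: ler_wpDr.
  by apply: sumr_ge0 => j _; rewrite invr_ge0 mulr_ge0 ?ler0n.
by rewrite lef_pV2 ?ler_nat // posrE ltr0n.
Qed.

(** Summation by parts: by [inv_le_telescope] the sum is at most size G / D
    plus the sum over 1 <= j < D of the number of a in G with ht a <= j, which is
    at most 27 j^3, divided by j (j + 1). *)
Lemma sum_inv_ht (G : seq 'rV[int]_3) (D M : nat) :
    uniq G -> (0 < D)%N -> {in G, forall a, (0 < ht a)%N} ->
    (size G <= M)%N ->
  \sum_(a <- G) (ht a)%:R^-1 <= M%:R / D%:R + 27 * D%:R ^+ 2 :> rat.
Proof.
move=> uG D0 G0 GM.
apply: (@le_trans _ _ (\sum_(a <- G) (D%:R^-1 +
   \sum_(1 <= j < D | (ht a <= j)%N) (j%:R * j.+1%:R)^-1))).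
  rewrite big_seq [leRHS]big_seq; apply: ler_sum => a /G0 a0.
  exact: inv_le_telescope.
rewrite big_split /=; apply: lerD.
  rewrite big_const_seq count_predT iter_addr_0 -[leLHS]mulr_natl.
  by rewrite ler_wpM2r ?invr_ge0 ?ler0n // ler_nat.
under eq_bigr do rewrite big_mkcond.
rewrite exchange_big /=.
apply: (@le_trans _ _ (\sum_(1 <= j < D) 27 * D%:R)); last first.
  rewrite big_const_nat iter_addr_0 -[leLHS]mulr_natl expr2 [leRHS]mulrA [leRHS]mulrC.
  by rewrite ler_wpM2r ?mulr_ge0 ?ler0n // ler_nat leq_subr.
rewrite big_nat [leRHS]big_nat; apply: ler_sum => j /andP[j0 jD].
rewrite -big_mkcond /= -big_filter big_const_seq count_predT iter_addr_0.
have jle : (size [seq a <- G | (ht a <= j)%N] <= (2 * j).+1 ^ 3)%N.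
  apply: size_le_box; first exact: filter_uniq.
  by move=> a; rewrite mem_filter => /andP[].
have pos : 0 < j%:R * j.+1%:R :> rat by rewrite mulr_gt0 ?ltr0n.
rewrite -[leLHS]mulr_natl (ler_pdivrMr _ _ pos).
rewrite -!natrM ler_nat; apply: leq_trans jle _.
rewrite !expnS expn0 muln1; nia.
Qed.

Lemma exists_sqrt (m : nat) : (0 < m)%N ->
  exists K, (m <= K.+1 ^ 2)%N /\ (K ^ 2 < m)%N.
Proof.
move=> m0; have ex : exists K, (m <= K.+1 ^ 2)%N.
  by exists m; rewrite expnS expn1; nia.
case: (ex_minnP ex) => K hK minK; exists K; split => //.
case: K hK minK => [//|K] _ minK; rewrite ltnNge; apply/negP => /minK.
by rewrite ltnn.
Qed.

Lemma size_fibers (T U : eqType) (f : T -> U) (s : seq T) :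
  size s = (\sum_(u <- undup [seq f x | x <- s]) count (fun x => f x == u) s)%N.
Proof.
under eq_bigr do rewrite -sum1_count big_mkcond.
rewrite exchange_big /= -sum1_size big_seq [RHS]big_seq; apply: eq_bigr => x xs.
rewrite (bigD1_seq (f x)) ?undup_uniq ?mem_undup ?map_f //= eqxx big1 ?addn0 //.
by move=> u /negPf; rewrite eq_sym => ->.
Qed.

(** D stands for the cube root of the degree, and K below for the square root
    of 6N.  For N <= D^2 the number of all integer vectors in the box is small
    enough.  For N > D^2 each x is assigned to a short primitive vector f x
    orthogonal to it, and the fibers of f are bounded according to whether F
    vanishes on the plane orthogonal to f x.  The constant exceeds the sum
    1458 + 2511 of the two contributions. *)
Lemma size_zeros_le n F (s : seq 'rV[int]_3) (D N : nat) :
    F \is n.-homog -> F != 0 -> (n <= 2 * D ^ 3)%N -> (0 < D)%N -> (0 < N)%N ->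
    {in s, forall x, [/\ x != 0, (ht x <= N)%N & F.@[fun i => toQ x 0 i] = 0]} ->
    uniq [seq <[toQ x]>%VS | x <- s] ->
  (size s <= 4000 * (D ^ 2 * N ^ 2))%N.
Proof.
move=> homF F0 nD D0 N0 sP ul.
have us : uniq s by exact: map_uniq ul.
have [ND|DN] := leqP N (D ^ 2).
  have : (size s <= (2 * N).+1 ^ 3)%N by apply: size_le_box => // x /sP[].
  move/leq_trans; apply; move: N0 D0 ND; rewrite !expnS !expn0 !muln1.
  clear; move=> N0 D0; move: (D * D)%N => E. nia.
have [K [NK KN]] : exists K, (6 * N <= K.+1 ^ 2)%N /\ (K ^ 2 < 6 * N)%N.
  by apply: exists_sqrt; lia.
have /choice[f fP] : forall x, exists a, x \in s ->
    [/\ primitive a, dot a x = 0 & (ht a <= K)%N].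
  move=> x; case: (boolP (x \in s)) => [xs|]; last by exists 0.
  have [x0 xN _] := sP x xs; have [a aP] := short_orthogonal N0 xN NK.
  by exists a.
pose A := undup [seq f x | x <- s].
have AP a : a \in A -> primitive a /\ (ht a <= K)%N.
  by rewrite mem_undup => /mapP[x xs ->]; have [] := fP x xs.
pose inF a := `[< forall v, dot (toQ a) v = 0 -> F.@[fun i => v 0 i] = 0 >].
pose c a := count (fun x => f x == a) s.
have cE a : c a = size [seq x <- s | f x == a] by rewrite size_filter.
have fiberP a x : x \in [seq x <- s | f x == a] ->
    [/\ x \in s, primitive a & dot a x = 0].
  rewrite mem_filter => /andP[/eqP <- xs]; by have [] := fP x xs.
have bad a : a \in A -> ~~ inF a -> (c a <= n.+1)%N.
  move=> aA /asboolPn/existsNP[p /not_implyP[ap /eqP Fp]].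
  rewrite cE -(size_map toQ); apply: (zeros_on_plane (a := toQ a) homF _ ap Fp).
  - by rewrite toQ_eq0 primitive_neq0 //; case: (AP a aA).
  - move=> _ /mapP[x /fiberP[xs _ ax] ->]; have [x0 _ Fx] := sP x xs.
    by rewrite toQ_eq0 dot_toQ ax.
  - rewrite -map_comp; apply: subseq_uniq ul.
    by apply: map_subseq; apply: filter_subseq.
have good a : a \in A -> (c a * ht a <= 81 * N ^ 2)%N.
  move=> aA; have [pa aK] := AP a aA; rewrite cE.
  apply: leq_trans (points_on_plane (N := N) pa _ _) _.
  - exact: filter_uniq.
  - by move=> x /fiberP[xs _ ax]; have [_ ? _] := sP x xs.
  (* 2N + ht a + 1 <= 9N, as ht a <= K <= 6N *)
  - rewrite -(expnMn 9 N 2) leq_exp2r //.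
    move: KN; rewrite expnS expn1; nia.
have -> : size s = (\sum_(a <- A | ~~ inF a) c a + \sum_(a <- A | inF a) c a)%N.
  by rewrite (size_fibers f) -/A (bigID inF) /= addnC.
(* 1458 = 27 * 3 * 6 * 3, from K^2 < 6N and K D <= 3N *)
have hbad : (\sum_(a <- A | ~~ inF a) c a <= 1458 * (D ^ 2 * N ^ 2))%N.
  apply: (@leq_trans ((2 * K).+1 ^ 3 * n.+1)%N).
    apply: (@leq_trans (\sum_(a <- A | ~~ inF a) n.+1)%N).
      rewrite big_seq_cond [leqRHS]big_seq_cond; apply: leq_sum => a /andP[].
      exact: bad.
    rewrite big_const_seq iter_addn_0 mulnC leq_mul2r; apply/orP; right.
    apply: leq_trans (count_size _ _) _.
    apply: size_le_box; first exact: undup_uniq.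
    by move=> a /AP[].
  have KD : (K * D <= 3 * N)%N.
    by rewrite -leq_sqr !expnMn; move: KN DN; clear; nia.
  have K1 : (0 < K)%N by move: NK N0; clear; case: K => //; lia.
  apply: (@leq_trans ((3 * K) ^ 3 * (3 * D ^ 3))%N).
    apply: leq_mul; first by rewrite leq_exp2r //; lia.
    have : (0 < D ^ 3)%N by rewrite expn_gt0 D0.
    lia.
  have -> : ((3 * K) ^ 3 * (3 * D ^ 3) = 81 * D ^ 2 * (K ^ 2 * (K * D)))%N.
    by rewrite !expnS !expn0; ring.
  have -> : (1458 * (D ^ 2 * N ^ 2) = 81 * D ^ 2 * (6 * N * (3 * N)))%N.
    by rewrite !expnS !expn0; ring.
  by rewrite leq_mul // leq_mul // ltnW.
(* 2511 = 81 * (4 + 27), from [sum_inv_ht] with 2n <= 4 D^3 *)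
have hgood : (\sum_(a <- A | inF a) c a <= 2511 * (D ^ 2 * N ^ 2))%N.
  rewrite -(ler_nat rat) natr_sum -big_filter.
  set G := [seq a <- A | inF a].
  have GA a : a \in G -> a \in A by rewrite mem_filter => /andP[].
  have G0 a : a \in G -> (0 < ht a)%N.
    by move=> /GA/AP[pa _]; rewrite lt0n ht_eq0 primitive_neq0.
  apply: (@le_trans _ _ ((81 * N ^ 2)%:R * \sum_(a <- G) (ht a)%:R^-1)).
    rewrite mulr_sumr big_seq [leRHS]big_seq; apply: ler_sum => a aG.
    rewrite ler_pdivlMr ?ltr0n ?G0 // -natrM ler_nat.
    exact/good/GA.
  have : (size G <= 2 * n)%N.
    apply: (planes_in_zeros homF F0); first exact/filter_uniq/undup_uniq.
    move=> a; rewrite mem_filter => /andP[/asboolP aF /AP[]].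
    by split.
  have uG : uniq G by exact/filter_uniq/undup_uniq.
  have := sum_inv_ht uG D0 G0 => /[apply] sumG.
  apply: le_trans (ler_wpM2l _ sumG) _; first exact: ler0n.
  have h : (2 * n)%:R / D%:R <= 4 * D%:R ^+ 2 :> rat.
    rewrite ler_pdivrMr ?ltr0n // -natrX -!natrM ler_nat -mulnA -expnSr.
    by move: nD; clear; lia.
  apply: (@le_trans _ _ ((81 * N ^ 2)%:R * (4 * D%:R ^+ 2 + 27 * D%:R ^+ 2))).
    by apply: ler_wpM2l; [exact: ler0n | rewrite lerD2r].
  by rewrite !natrM le_eqVlt; apply/orP; left; apply/eqP; ring.
by move: hbad hgood; lia.
Qed.

(** * Graded pieces of homogeneous ideals *)

Notation poly3 := {mpoly rat[3]}.
Notation form m := (dhomog 3 rat m).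

(** Take a subspace of maximal dimension among those contained in A.  This
    gives a dimension to the graded pieces of an ideal, which is just a set of
    polynomials. *)
Lemma linear_set_vspace (vT : vectType rat) (A : set vT) :
    A 0 -> (forall c u v, A u -> A v -> A (c *: u + v)) ->
  exists U : {vspace vT}, forall v, v \in U <-> A v.
Proof.
move=> A0 Alin.
pose Q n := `[< exists U : {vspace vT}, \dim U = n /\ forall v, v \in U -> A v >].
have exQ : exists n, Q n.
  exists 0; apply/asboolP; exists 0%VS; rewrite dimv0; split=> // v.
  by rewrite memv0 => /eqP ->.
have bQ n : Q n -> (n <= \dim {:vT})%N.
  by move=> /asboolP[U [<- _]]; apply/dimvS/subvf.
case: (ex_maxnP exQ bQ) => n /asboolP[U [dU UA]] maxn.
exists U => v; split=> [/UA//|Av]; apply/negPn/negP => vU.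
have : Q (\dim (U + <[v]>)%VS).
  apply/asboolP; exists (U + <[v]>)%VS; split=> // x /memv_addP[y yU [z]].
  by case/vlineP => c -> ->; rewrite addrC; apply: Alin => //; exact: UA.
move=> /maxn; rewrite -dU; apply/negP.
rewrite -ltnNge ltn_neqAle dimvS ?addvSl // andbT.
apply: contra vU => /eqP e; have : (U == U + <[v]>)%VS.
  by rewrite eqEdim addvSl e leqnn.
by move/eqP => ->; rewrite memvE addvSr.
Qed.

Definition slice (I : set poly3) m : {vspace form m} :=
  xget 0%VS [set U : {vspace form m} | forall v, v \in U <-> I (val v)].

Lemma mem_slice I m (v : form m) : homogeneous_ideal I ->
  v \in slice I m <-> I (val v).
Proof.
case=> I0 ID IM _.
have [U UP] : exists U : {vspace form m}, forall v, v \in U <-> I (val v).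
  apply: (@linear_set_vspace _ [set v : form m | I (val v)]) => //= c u v' Iu Iv.
  by apply: ID => //; rewrite -mul_mpolyC; exact: IM.
have : [set U : {vspace form m} | forall v, v \in U <-> I (val v)] (slice I m).
  by apply: xgetPex; exists U.
exact.
Qed.

(** The projection to degree n makes multiplication by f linear for all m and
    n, and avoids casts between the types of forms of degrees n and k + m;
    [val_mulf] removes the projection. *)
Definition mulform (f : poly3) m n (p : form m) : form n :=
  DHomog (pihomogP mdeg n (f * val p)).

Lemma mulform_is_linear f m n : linear (@mulform f m n).
Proof.
by move=> c u v; apply: val_inj; rewrite /= mulrDr -scalerAr linearP.
Qed.

HB.instance Definition _ f m n :=
  GRing.isLinear.Build rat (form m) (form n) _ (@mulform f m n)
    (@mulform_is_linear f m n).

Definition mulf f m n : 'Hom(form m, form n) := linfun (@mulform f m n).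

Lemma val_mulf f k m n (p : form m) : f \is k.-homog -> n = (k + m)%N ->
  val (mulf f m n p) = f * val p.
Proof.
move=> hf ->; rewrite lfunE /= pihomog_dE //.
by apply: dhomogM => //; apply: dhomog_is_dhomog.
Qed.

Lemma pihomogM f k m (p : poly3) : f \is k.-homog ->
  pihomog mdeg (k + m) (f * p) = f * pihomog mdeg m p.
Proof.
move=> hf.
rewrite [in LHS](@pihomog_partitionE _ _ mdeg (msize p + m.+1) p) ?leq_addr //.
rewrite mulr_sumr raddf_sum /=.
have hm : (m < msize p + m.+1)%N by rewrite addnS ltnS leq_addl.
rewrite (bigD1 (Ordinal hm)) //= big1 ?addr0.
  by rewrite pihomog_dE // dhomogM // pihomogP.
move=> i ne; apply: (@pihomog_ne0 _ _ mdeg (k + i)); last first.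
  by rewrite dhomogM // pihomogP.
by rewrite eqn_add2l; apply: contra ne => /eqP e; apply/eqP/val_inj.
Qed.

Lemma dim_form m : \dim (fullv : {vspace form m}) = 'C(m + 2, 2).
Proof. by rewrite dimvf -bin_sub ?leq_addl // addnK. Qed.

Lemma dim_mulf f k m n (U : {vspace form m}) : f \is k.-homog -> f != 0 ->
  n = (k + m)%N -> \dim (mulf f m n @: U)%VS = \dim U.
Proof.
move=> hf f0 e; apply: limg_dim_eq; apply/eqP; rewrite -subv0; apply/subvP => v.
rewrite memv_cap memv_ker memv0 => /andP[_ /eqP] /(congr1 val).
rewrite (val_mulf _ hf e) /= => /eqP; rewrite mulf_eq0 (negPf f0) /= => /eqP v0.
by apply/eqP/val_inj.
Qed.

(** The ideal generated by I and f. *)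
Definition adjoin (I : set poly3) (f : poly3) : set poly3 :=
  [set q | exists p A, I p /\ q = p + f * A].

Lemma adjoin_ideal I f k : homogeneous_ideal I -> f \is k.-homog ->
  homogeneous_ideal (adjoin I f).
Proof.
case=> I0 ID IM Ih hf; split.
- by exists 0, 0; rewrite mulr0 addr0.
- move=> _ _ [p [A [Ip ->]]] [q [B [Iq ->]]]; exists (p + q), (A + B).
  by split; [exact: ID | rewrite mulrDr addrACA].
- move=> r _ [p [A [Ip ->]]]; exists (r * p), (r * A).
  by split; [exact: IM | rewrite mulrDr mulrCA].
- move=> _ e [p [A [Ip ->]]]; rewrite raddfD /=.
  have [ke|ek] := leqP k e.
    exists (pihomog mdeg e p), (pihomog mdeg (e - k) A).
    by split; [exact: Ih | rewrite -(pihomogM _ _ hf) subnKC].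
  exists (pihomog mdeg e p), 0; split; first exact: Ih.
  rewrite mulr0 (@pihomog_partitionE _ _ mdeg (msize A) A) //.
  rewrite mulr_sumr raddf_sum /= big1 // => i _.
  apply: (@pihomog_ne0 _ _ mdeg (k + i)); last by rewrite dhomogM // pihomogP.
  by rewrite gtn_eqF // (leq_trans ek) // leq_addr.
Qed.

Lemma sub_adjoin I f : I `<=` adjoin I f.
Proof. by move=> p Ip; exists p, 0; rewrite mulr0 addr0. Qed.

Lemma mem_adjoin I f : homogeneous_ideal I -> adjoin I f f.
Proof. by case=> I0 _ _ _; exists 0, 1; rewrite add0r mulr1. Qed.

Lemma adjoin_homog I f k m q : homogeneous_ideal I -> f \is k.-homog ->
    q \is (k + m).-homog -> adjoin I f q ->
  exists p A, [/\ I p, p \is (k + m).-homog, A \is m.-homog & q = p + f * A].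
Proof.
move=> [_ _ _ Ih] hf hq [p [A [Ip e]]].
exists (pihomog mdeg (k + m) p), (pihomog mdeg m A).
split; [exact: Ih | exact: pihomogP | exact: pihomogP |].
by rewrite -(pihomogM _ _ hf) -raddfD /= -e pihomog_dE.
Qed.

Lemma slice_adjoin I f k m n : homogeneous_ideal I -> f \is k.-homog ->
    n = (k + m)%N ->
  slice (adjoin I f) n = (slice I n + mulf f m n @: fullv)%VS.
Proof.
move=> hI hf en; have hJ := adjoin_ideal hI hf.
apply/eqP; rewrite eqEsubv; apply/andP; split; apply/subvP => v.
  move/(mem_slice _ hJ) => vJ.
  have hv : val v \is (k + m).-homog by rewrite -en; apply: dhomog_is_dhomog.
  have [p [A [Ip hp hA e]]] := adjoin_homog hI hf hv vJ.
  rewrite -en in hp; apply/memv_addP; exists (DHomog hp); first exact/mem_slice.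
  exists (mulf f m n (DHomog hA)); first by rewrite memv_img // memvf.
  by apply: val_inj; rewrite e /= (val_mulf _ hf en).
case/memv_addP => p /(mem_slice _ hI) Ip [_ /memv_imgP[A _ ->] ->].
apply/mem_slice => //; exists (val p), (val A); split=> //=.
by rewrite (val_mulf _ hf en).
Qed.

Definition hilbert_fun I m := (\dim (fullv : {vspace form m}) - \dim (slice I m))%N.

Lemma dim_slice_hilbert I m :
  (\dim (slice I m) + hilbert_fun I m)%N = \dim (fullv : {vspace form m}).
Proof. by rewrite subnKC // dimvS // subvf. Qed.

Lemma proj_prime_neq0 (P : set poly3) f : homogeneous_ideal P -> ~ P f -> f != 0.
Proof. by case=> P0 _ _ _ Pf; apply/eqP => f0; apply: Pf; rewrite f0. Qed.

(** As P is prime, a multiple f q belongs to P only if q does: multiplication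
    by f embeds the degree m part of the quotient ring in its degree n part. *)
Lemma dim_slice_adjoin P f k m n : proj_prime P -> f \is k.-homog -> ~ P f ->
    n = (k + m)%N ->
  \dim (slice (adjoin P f) n) = (\dim (slice P n) + hilbert_fun P m)%N.
Proof.
move=> [hP _ Pp _] hf Pf en; have f0 := proj_prime_neq0 hP Pf.
rewrite (slice_adjoin hP hf en); apply/eqP.
rewrite -(eqn_add2r (\dim (slice P m))) -addnA [(hilbert_fun _ _ + _)%N]addnC.
rewrite dim_slice_hilbert -[X in _ == (_ + X)%N](dim_mulf _ hf f0 en).
rewrite -dimv_sum_cap.
rewrite eqn_add2l -[X in X == _](dim_mulf _ hf f0 en); apply/eqP; congr (\dim _)%VS.
apply/eqP; rewrite eqEsubv; apply/andP; split; apply/subvP => v.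
  case/memv_imgP => q /(mem_slice _ hP) Pq ->.
  rewrite memv_cap memv_img ?memvf // andbT.
  by apply/mem_slice => //; rewrite (val_mulf _ hf en); case: hP => _ _ PM _; exact: PM.
rewrite memv_cap => /andP[/(mem_slice _ hP) + /memv_imgP[q _ e]].
rewrite e (val_mulf _ hf en) => /Pp[//|Pq]; apply/memv_img.
exact/mem_slice.
Qed.

Lemma hilbert_fun_value I m k : homogeneous_ideal I -> hilbert_value I m k ->
  hilbert_fun I m = k.
Proof.
move=> hI [b [hb bfree bspan]].
pose X := [tuple (DHomog (hb i) : form m) | i < k].
have XE (c : 'I_k -> rat) : val (\sum_i c i *: X`_i) = \sum_i c i *: b i.
  rewrite raddf_sum /=; apply: eq_bigr => i _; congr (_ *: _).
  by rewrite (nth_map i) ?size_enum_ord // nth_ord_enum.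
have X0 : (slice I m :&: <<X>> = 0)%VS.
  apply/eqP; rewrite -subv0; apply/subvP => v; rewrite memv_cap memv0.
  case/andP => /(mem_slice _ hI) Iv /coord_span ev; move: Iv; rewrite ev XE.
  move=> /bfree c0; apply/eqP; rewrite big1 // => i _.
  by rewrite c0 scale0r.
have Xfree : free X.
  apply/freeP => c /(congr1 val); rewrite XE => c0; apply: bfree; rewrite c0.
  by case: hI.
have Xfull : (slice I m + <<X>>)%VS = fullv.
  apply/eqP; rewrite eqEsubv subvf; apply/subvP => v _.
  have [a Ia] := bspan (val v) (dhomog_is_dhomog v).
  apply/memv_addP; exists (v - \sum_i a i *: X`_i).
    by apply/mem_slice => //; rewrite raddfB /= XE.
  exists (\sum_i a i *: X`_i); last by rewrite subrK.
  by apply: memv_suml => i _; rewrite memvZ // memv_span // mem_nth // size_tuple.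
have := dimv_disjoint_sum X0; rewrite Xfull (eqP Xfree) size_tuple /hilbert_fun => ->.
by rewrite addKn.
Qed.

(** * Forms of low degree in the prime of a curve *)

Lemma ideal_sub (I : set poly3) p q : homogeneous_ideal I -> I p -> I q -> I (p - q).
Proof. by case=> _ ID IM _ Ip Iq; apply: ID => //; rewrite -mulN1r; exact: IM. Qed.

(** Modulo I the variable X_i is v_i X_2. *)
Lemma eval_congr I (v : 'I_3 -> rat) m (p : poly3) : homogeneous_ideal I ->
    (forall i, I ('X_i - v i *: 'X_2)) -> p \is m.-homog ->
  I (p - p.@[v] *: 'X_2 ^+ m).
Proof.
move=> hI Iv hp; have [I0 ID IM _] := hI.
have Ipow (a b : poly3) k : I (a - b) -> I (a ^+ k - b ^+ k).
  by move=> Iab; rewrite subrXX mulrC; apply: IM.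
have Imul (a b c d : poly3) : I (a - b) -> I (c - d) -> I (a * c - b * d).
  move=> Iab Icd; have -> : a * c - b * d = c * (a - b) + b * (c - d) by ring.
  by apply: ID; exact: IM.
rewrite mevalE scaler_suml {1}[p]mpolyE -sumrB big_seq.
apply: big_ind => // mu mup.
have -> : 'X_2 ^+ m = \prod_(i < 3) 'X_2 ^+ mu i :> poly3.
  by rewrite prodrXr -mdegE (dhomog_mf hp).
rewrite -scalerA -scalerBr -[X in I X]mul_mpolyC; apply: IM.
rewrite mpolyXE_id -scaler_prod.
apply: (big_ind2 (fun a b => I (a - b))); rewrite ?subrr //.
by move=> i _; rewrite -exprZn; apply: Ipow.
Qed.

Lemma prime_pow (P : set poly3) f k : proj_prime P -> P (f ^+ k) -> P f.
Proof.
case=> _ P1 Pp _; elim: k => [|k IH]; first by rewrite expr0.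
by rewrite exprS => /Pp[].
Qed.

Lemma hilbert_funD (P : set poly3) e M m k :
  (forall m, (M <= m)%N -> hilbert_fun P m.+1 = (hilbert_fun P m + e)%N) ->
  (M <= m)%N -> hilbert_fun P (m + k) = (hilbert_fun P m + e * k)%N.
Proof.
move=> hilbertS Mm; elim: k => [|k IH]; first by rewrite muln0 !addn0.
by rewrite addnS hilbertS ?(leq_trans Mm) ?leq_addr // IH mulnS -addnA [(e + _)%N]addnC.
Qed.

(** Induction on N: the cofactor of w^N still has degree at least D, so it can
    be decomposed in turn along P, w and u. *)
Lemma adjoin_pow (P : set poly3) u w D N m p : homogeneous_ideal P ->
    u \is 1.-homog -> w \is 1.-homog ->
    (forall m p, (D <= m)%N -> p \is m.-homog -> adjoin (adjoin P w) u p) ->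
    (D + N <= m)%N -> p \is m.-homog ->
  adjoin (adjoin P (w ^+ N)) u p.
Proof.
move=> hP hu hw full; elim: N m p => [|N IH] m p.
  move=> _ _; exists p, 0; rewrite mulr0 addr0; split=> //.
  by exists 0, p; rewrite expr0 mul1r add0r; case: hP.
have hwN k : w ^+ k \is k.-homog by rewrite -[in k.-homog](mul1n k) dhomogMn.
rewrite addnS => DNm hp.
have hp1 : p \is (1 + m.-1).-homog.
  by rewrite add1n prednK // (leq_trans _ DNm).
have [q [A [Qq hq hA ->]]] :=
  adjoin_homog (adjoin_ideal hP (hwN N)) hu hp1 (IH m p (ltnW DNm) hp).
have mE : (1 + m.-1 = N + (m - N))%N by lia.
rewrite mE in hq.
have [p0 [B [Pp0 hp0 hB ->]]] := adjoin_homog hP (hwN N) hq Qq.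
have hmN : (D <= m - N)%N by lia.
have [q' [A' [[p1 [B' [Pp1 ->]]] ->]]] := full _ _ hmN hB.
exists (p0 + w ^+ N * p1 + w ^+ N.+1 * B'), (w ^+ N * A' + A); split.
  exists (p0 + w ^+ N * p1), B'; split=> //.
  by case: hP => _ PD PM _; apply: PD => //; exact: PM.
by rewrite exprSr; ring.
Qed.

Section Curve.
Variables (P : set poly3) (e M : nat).
Hypothesis Pprime : proj_prime P.
Hypothesis e_gt0 : (0 < e)%N.
Hypothesis hilbertS : forall m, (M <= m)%N ->
  hilbert_fun P m.+1 = (hilbert_fun P m + e)%N.

Let hP : homogeneous_ideal P. Proof. by case: Pprime. Qed.

(** The Hilbert function of P grows linearly, and the dimension of the space of
    all forms quadratically. *)
Lemma prime_form : exists D (G : poly3), [/\ G != 0, G \is D.-homog & P G].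
Proof.
pose c := hilbert_fun P M; pose m := (M + 2 * (c + e))%N.
have : (0 < \dim (slice P m))%N.
  have := dim_slice_hilbert P m.
  rewrite (hilbert_funD _ hilbertS) // -/c dim_form bin2 /m.
  move=> h; rewrite lt0n; apply/eqP => d0; move: h; rewrite d0 add0n => h.
  have := odd_double_half ((M + 2 * (c + e) + 2) * (M + 2 * (c + e) + 2).-1).
  rewrite -h -muln2; case: odd; nia.
rewrite lt0n dimv_eq0 => s0; have vs := memv_pick (slice P m).
exists m, (val (vpick (slice P m))); split.
- by apply: contra s0 => /eqP v0; rewrite -vpick0; apply/eqP/val_inj.
- exact: dhomog_is_dhomog.
- exact/mem_slice.
Qed.

Lemma point_off_curve : exists (v : 'I_3 -> rat) D (G : poly3),
  [/\ v 2 = 1, G.@[v] != 0, G \is D.-homog & P G].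
Proof.
have [D [G [G0 hG PG]]] := prime_form.
have /exists_nonzero[v] : 'X_2 * G != 0.
  rewrite mulf_neq0 //; apply/eqP => /(congr1 (mcoeff U_(2)%MM)).
  by rewrite mcoeffXU eqxx mcoeff0 => /eqP; rewrite oner_eq0.
rewrite mevalM mevalXU mulf_eq0 negb_or => /andP[v2 Gv].
exists (fun i => (v 2)^-1 * v i), D, G; split=> //; first by rewrite mulVf.
have := meval_homogZ (v 2)^-1 (\row_i v i) hG.
rewrite (@meval_eq _ _ _ (fun i => (v 2)^-1 * v i)); last by move=> i; rewrite !mxE.
rewrite (@meval_eq _ _ (fun i => (\row_i v i) 0 i) v); last by move=> i; rewrite !mxE.
by move=> ->; rewrite mulf_neq0 // expf_neq0 // invr_neq0.
Qed.

(** The point v of [point_off_curve] is the only common zero of the linear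
    forms X_i - v_i X_2, so they have no common zero on the curve.
    Algebraically: modulo these forms and P every form of degree m is a multiple
    of X_2^m, and G, which does not vanish at v, makes X_2^D zero. *)
Lemma linear_parameters : exists u w D,
  [/\ u \is 1.-homog, w \is 1.-homog, u != 0, ~ P w &
  forall m (p : poly3), (D <= m)%N -> p \is m.-homog -> adjoin (adjoin P w) u p].
Proof.
have [v [D [G [v2 Gv hG PG]]]] := point_off_curve.
pose l i : poly3 := 'X_i - v i *: 'X_2.
have hl i : l i \is 1.-homog.
  have hX k : ('X_k : poly3) \is 1.-homog by rewrite dhomogX; apply/eqP/mdeg1.
  by rewrite rpredB ?rpredZ.
have X2 J : homogeneous_ideal J -> P `<=` J -> (forall i, J (l i)) ->
    J ('X_2 ^+ D).
  move=> hJ PJ Jl; have := ideal_sub hJ (PJ _ PG) (eval_congr hJ Jl hG).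
  rewrite opprB addrC subrK => JG; have [_ _ JM _] := hJ.
  by rewrite -(scalerK Gv ('X_2 ^+ D)) -mul_mpolyC; apply: JM.
have [i Pli] : exists i, ~ P (l i).
  apply/existsNP => Pl; have := X2 P hP (@subset_refl _ _) Pl.
  move=> /(prime_pow Pprime) P2; case: (Pprime) => _ _ _ [i]; apply.
  rewrite -[X in P X](subrK (v i *: 'X_2)); have [_ PD PM _] := hP.
  by apply: PD; [exact: Pl | rewrite -mul_mpolyC; exact: PM].
have l2 : l 2 = 0 by rewrite /l v2 scale1r subrr.
have ij : exists2 j, forall k, k != i -> k != j -> l k = 0 & l j != 0.
  exists (if i == 0 then 1 else 0).
    move=> k; case: (i =P 0) => [->|i0] k1 k2.
      by move: k1 k2; case: (ord3 k) => [->|[->|->]].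
    have i1 : i = 1.
      case: (ord3 i) => [//|[//|i2]].
      by case: Pli; rewrite i2 l2; case: hP.
    by move: k1 k2; rewrite i1; case: (ord3 k) => [->|[->|->]].
  set j : 'I_3 := if _ then _ else _.
  have j2 : (2 == j) = false by rewrite /j; case: ifP.
  apply/eqP => /(congr1 (mcoeff U_(j))); rewrite mcoeffB mcoeffZ !mcoeffXU.
  by rewrite eqxx mcoeff0 j2 mulr0 subr0 => /eqP; rewrite oner_eq0.
case: ij => j lk lj; exists (l j), (l i), D; split=> // m p Dm hp.
have hJ1 := adjoin_ideal hP (hl i); have hJ := adjoin_ideal hJ1 (hl j).
set J := adjoin _ _ in hJ *; have [J0 JD JM _] := hJ.
have PJ : P `<=` J by apply: subset_trans (@sub_adjoin _ _) (@sub_adjoin _ _).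
have Jl k : J (l k).
  have [->|ki] := eqVneq k i.
    exact/sub_adjoin/mem_adjoin.
  have [->|kj] := eqVneq k j.
    exact: mem_adjoin.
  by rewrite lk.
rewrite -(subrK (p.@[v] *: 'X_2 ^+ m) p); apply: JD; first exact: eval_congr.
rewrite -mul_mpolyC -(subnK Dm) exprD mulrA; apply: JM. exact: (X2 J hJ PJ Jl).
Qed.
(** Put d = 2e and N = d + 1, and let W be the ideal generated by P and w^N; it
    has codimension eN in each large degree.  Multiplication by u modulo W is
    onto in large degrees by [adjoin_pow], hence injective, the dimensions being
    equal.  The forms of degree d have dimension (d + 1) (d + 2) / 2 > eN, so
    u^m0 F is in W for some F != 0, and by injectivity F s is in W for all s of
    degree m0.  If F were not in P, then s |-> F s / w^N would embed the degree
    m0 part of the quotient by P in its degree m0 + d - N = m0 - 1 part, which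
    has smaller dimension. *)
Lemma low_degree_form :
  exists F : poly3, [/\ F != 0, F \is (2 * e).-homog & P F].
Proof.
have hilbertD m k := @hilbert_funD P e M m k hilbertS.
have [u [w [D [hu hw u0 Pw full]]]] := linear_parameters.
pose d := (2 * e)%N; pose N := d.+1; pose W := adjoin P (w ^+ N).
have hpow (f : poly3) k : f \is 1.-homog -> f ^+ k \is k.-homog.
  by move=> hf; rewrite -[in k.-homog](mul1n k) dhomogMn.
have hwN := hpow w N hw.
have PwN : ~ P (w ^+ N) by move/(prime_pow Pprime).
have hW : homogeneous_ideal W by exact: adjoin_ideal hP hwN.
pose m0 := (D + M + N)%N.
have dimW m : (m0 <= m)%N ->
    (\dim (slice W m) + e * N)%N = \dim (fullv : {vspace form m}).
  move=> m0m; have mE : m = (N + (m - N))%N by rewrite /m0 in m0m; lia.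
  rewrite (dim_slice_adjoin Pprime hwN PwN mE) -addnA -hilbertD.
    by rewrite [(m - N + N)%N]addnC -mE dim_slice_hilbert.
  by rewrite /m0 in m0m; lia.
(* a surjection between spaces of equal dimension *)
have uinj m s : (m0 <= m)%N -> s \is m.-homog -> W (u * s) -> W s.
  move=> m0m hs Wus; pose v := DHomog hs : form m.
  have sumU : (mulf u m m.+1 @: fullv + slice W m.+1 = fullv)%VS.
    rewrite addvC -(slice_adjoin hW hu (esym (add1n m))).
    apply/eqP; rewrite eqEsubv subvf; apply/subvP => x _.
    apply/mem_slice; first exact: adjoin_ideal hW hu.
    apply: adjoin_pow hP hu hw full _ (dhomog_is_dhomog x).
    by rewrite /m0 in m0m; lia.
  have sub : (mulf u m m.+1 @: slice W m <= mulf u m m.+1 @: fullv :&: slice W m.+1)%VS.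
    apply/subvP => x /memv_imgP[y /(mem_slice _ hW) Wy ->].
    rewrite memv_cap memv_img ?memvf //=; apply/mem_slice => //.
    by rewrite (val_mulf _ hu (esym (add1n m))); case: hW => _ _ WM _; exact: WM.
  have eqU : (mulf u m m.+1 @: slice W m = mulf u m m.+1 @: fullv :&: slice W m.+1)%VS.
    apply/eqP; rewrite eqEdim sub (dim_mulf _ hu u0 (esym (add1n m))) /=.
    have := dimv_sum_cap (mulf u m m.+1 @: fullv) (slice W m.+1).
    rewrite sumU (dim_mulf _ hu u0 (esym (add1n m))).
    have := dimW m m0m; have := dimW m.+1 (leqW m0m).
    move: (\dim (_ :&: _)) (\dim (slice W m.+1)) (\dim (slice W m)) (e * N)%N.
    by move: (\dim fullv) (\dim fullv); clear; lia.
  have : mulf u m m.+1 v \in (mulf u m m.+1 @: slice W m)%VS.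
    rewrite eqU memv_cap memv_img ?memvf //=; apply/mem_slice => //.
    by rewrite (val_mulf _ hu (esym (add1n m))).
  case/memv_imgP => y /(mem_slice _ hW) Wy /(congr1 val).
  by rewrite !(val_mulf _ hu (esym (add1n m))) => /(mulfI u0) /= ->.
have uinjX k m s : (m0 <= m)%N -> s \is m.-homog -> W (u ^+ k * s) -> W s.
  move=> m0m hs; elim: k => [|k IH]; first by rewrite expr0 mul1r.
  rewrite exprS -mulrA => /(@uinj (k + m)%N) Wk; apply/IH/Wk.
    by rewrite (leq_trans m0m) // leq_addl.
  by rewrite dhomogM // hpow.
(* the forms of degree d have dimension greater than the codimension of W *)
have [F [F0 hF WF]] : exists F : poly3, [/\ F != 0, F \is d.-homog & W (u ^+ m0 * F)].
  have hum := hpow u m0 hu; have um0 : u ^+ m0 != 0 by rewrite expf_neq0.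
  have : (0 < \dim (mulf (u ^+ m0) d (m0 + d) @: fullv :&: slice W (m0 + d)))%N.
    have := dimv_sum_cap (mulf (u ^+ m0) d (m0 + d) @: fullv) (slice W (m0 + d)).
    rewrite (dim_mulf _ hum um0 erefl).
    have := dimvS (subvf (mulf (u ^+ m0) d (m0 + d) @: fullv + slice W (m0 + d))%VS).
    rewrite -(dimW _ (leq_addr _ _)) [\dim (fullv : {vspace form d})]dim_form.
    have : (e * N < 'C(d + 2, 2))%N.
      rewrite addn2 /N /d bin2 /=.
      have := odd_double_half ((2 * e).+2 * (2 * e).+1).
      rewrite -muln2; move: e_gt0; clear; case: odd; nia.
    move: (\dim (_ :&: _)) (\dim (slice W (m0 + d))) (e * N)%N 'C(d + 2, 2).
    by move: (\dim (_ + _)); clear; lia.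
  rewrite lt0n dimv_eq0 -vpick0; set U := (_ :&: _)%VS; move: (memv_pick U).
  move: (vpick U) => x; rewrite memv_cap.
  move=> /andP[/memv_imgP[F _ xE] /(mem_slice _ hW) Wx] x0.
  exists (val F); split.
  - by apply: contra x0 => /eqP F0; rewrite xE; apply/eqP/val_inj;
      rewrite (val_mulf _ hum erefl) F0 mulr0.
  - exact: dhomog_is_dhomog.
  - by rewrite -(val_mulf F hum erefl) -xE.
exists F; split=> //; apply: contrapT => PF.
have sub : (slice (adjoin P F) (d + m0) <= slice W (d + m0))%VS.
  apply/subvP => x /(mem_slice _ (adjoin_ideal hP hF)) FPx.
  have [p [A [Pp _ hA xE]]] := adjoin_homog hP hF (dhomog_is_dhomog x) FPx.
  apply/mem_slice => //; rewrite /= in xE *; rewrite xE.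
  have [_ WD WM _] := hW; apply: WD; first exact: sub_adjoin.
  apply: (@uinjX m0 (d + m0)%N); first exact: leq_addl.
    exact: dhomogM.
  by rewrite mulrA mulrC; exact: WM.
have mE : (d + m0 = N + m0.-1)%N by rewrite /m0 /N; lia.
have := dimvS sub; rewrite (dim_slice_adjoin Pprime hF PF erefl).
rewrite (dim_slice_adjoin Pprime hwN PwN mE) leq_add2l.
have -> : m0 = m0.-1.+1 by rewrite /m0 /N; lia.
rewrite hilbertS /=; last by rewrite /m0 /N; lia.
by rewrite -[leqRHS]addn0 leq_add2l leqNgt e_gt0.
Qed.
End Curve.

(** * The equation of a plane curve *)

Lemma dim_ge_leq n (I : set {mpoly rat[n.+1]}) r s :
  (s <= r)%N -> dim_ge I r -> dim_ge I s.
Proof.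
move=> sr [Q [Q1 Q2]]; exists Q; split=> j js.
  by apply: Q1; exact: leq_trans sr.
by apply: Q2; exact: leq_trans sr.
Qed.

Lemma has_dim_uniq n (I : set {mpoly rat[n.+1]}) r s :
  has_dim I r -> has_dim I s -> r = s.
Proof.
move=> [r1 r2] [s1 s2]; apply/eqP; rewrite eqn_leq; apply/andP; split.
  by rewrite leqNgt; apply/negP => /dim_ge_leq /(_ r1).
by rewrite leqNgt; apply/negP => /dim_ge_leq /(_ s1).
Qed.

Lemma component_form (P : set poly3) e :
    proj_prime P -> has_dim P 1 -> integral_degree P e ->
  exists F : poly3, [/\ F != 0, F \is (2 * e).-homog & P F].
Proof.
move=> Pp dP [r [h [dPr [M hM] sh eh]]].
have hP : homogeneous_ideal P by case: Pp.
have r1 := has_dim_uniq dPr dP; rewrite r1 in sh eh.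
have {}eh : h`_1 = e%:R by rewrite eh factE mul1r lead_coefE sh.
have hE m : (M <= m)%N -> (hilbert_fun P m)%:R = h`_0 + e%:R * m%:R.
  case/hM => k hk; rewrite horner_coef sh !big_ord_recl big_ord0 /=.
  by rewrite (hilbert_fun_value hP hk) expr0 mulr1 expr1 addr0 -eh => <-.
apply: (low_degree_form (e := e) (M := M) Pp).
  rewrite lt0n -(eqr_nat rat) -eh -[1%N]/(2.-1) -sh -lead_coefE lead_coef_eq0.
  by rewrite -size_poly_eq0 sh.
move=> m Mm; apply/eqP; rewrite -(eqr_nat rat) natrD !hE //; last exact: leqW.
by rewrite -natr1 mulrDr mulr1 addrA.
Qed.

(** Zorn's lemma for the sets A such that Q minus A is a prime containing I:
    the intersection of a chain of primes is prime.  Removing sets from Q, rather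
    than taking complements, makes the empty chain give Q itself. *)
Lemma minimal_prime n (I Q : set {mpoly rat[n.+1]}) :
    proj_prime Q -> I `<=` Q ->
  exists P, irreducible_component I P /\ P `<=` Q.
Proof.
move=> Qp IQ; have [[Q0 QD QM Qh] Q1 Qpr [i0 Qi0]] := Qp.
pose good (A : set {mpoly rat[n.+1]}) := proj_prime A /\ I `<=` A.
have [|A [[Ap IA] maxA]] := @Zorn_bigcup _ [set A | good (Q `\` A)].
  move=> F Fgood Fchain.
  have mem p : Q p -> (forall X, F X -> (Q `\` X) p) ->
      (Q `\` \bigcup_(X in F) X) p.
    by move=> Qp' h; split=> // -[X FX]; case: (h X FX).
  have sub X p : F X -> (Q `\` \bigcup_(X in F) X) p -> (Q `\` X) p.
    by move=> FX [Qp' h]; split=> // Xp; apply: h; exists X.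
  have prime2 p q X : F X -> (Q `\` \bigcup_(X in F) X) (p * q) ->
      (Q `\` X) p \/ (Q `\` X) q.
    move=> FX pq; have [[_ _ Xpr _] _] := Fgood X FX.
    exact/Xpr/(sub _ _ FX).
  split; last first.
    move=> p Ip; apply: mem; first exact: IQ.
    by move=> X /Fgood[_]; apply.
  split.
  - split.
    + by apply: mem => // X /Fgood[[[]]].
    + move=> p q Tp Tq; apply: mem => [|X FX].
        by case: Tp Tq => Qp' _ [Qq _]; exact: QD.
      by have [[[_ XD _ _] _ _ _] _] := Fgood X FX; apply: XD; exact: sub.
    + move=> p q Tq; apply: mem => [|X FX]; first by case: Tq => Qq _; exact: QM.
      by have [[[_ _ XM _] _ _ _] _] := Fgood X FX; apply: XM; exact: sub.
    + move=> p e Tp; apply: mem => [|X FX]; first by case: Tp => Qp' _; exact: Qh.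
      by have [[[_ _ _ Xh] _ _ _] _] := Fgood X FX; apply: Xh; exact: sub.
  - by case=> /Q1.
  - move=> p q Tpq; apply: contrapT => /not_orP[Tp Tq].
    have [Qpq _] := Tpq.
    have out r : ~ (Q `\` \bigcup_(X in F) X) r -> ~ Q r \/ exists2 X, F X & X r.
      move=> Tr; have [Qr|] := pselect (Q r); [right|by left].
      by apply: contrapT => h; apply: Tr; split=> // -[X FX Xr]; apply: h; exists X.
    case: (out p Tp) (out q Tq) => [nQp|[X FX Xp]] [nQq|[Y FY Yq]].
    + by case: (Qpr p q Qpq).
    + by case: (prime2 p q Y FY Tpq) => -[].
    + by case: (prime2 p q X FX Tpq) => -[].
    + case: (Fchain X Y FX FY) => [XY|YX].
        by case: (prime2 p q Y FY Tpq) => -[_]; apply=> //; exact: XY.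
      by case: (prime2 p q X FX Tpq) => -[_]; apply=> //; exact: YX.
  - by exists i0 => -[].
exists (Q `\` A); split; last by move=> p [].
split=> // Q' Q'p IQ' Q'A; apply/seteqP; split=> // p [Qp' Ap'].
apply: contrapT => Q'p'; apply: (maxA (~` Q')).
  split=> [q Aq Q'q|]; first by have [] := Q'A q Q'q.
  by move/(_ p Q'p').
rewrite /= /good.
suff -> : Q `\` ~` Q' = Q' by [].
apply/seteqP; split=> q; first by case=> _ /contrapT.
by move=> Q'q; have [Qq _] := Q'A q Q'q; split.
Qed.

Section PointIdeal.
Variables (n : nat) (x : 'I_n.+1 -> rat).

(** Restriction to the line through the origin spanned by x.  Its kernel is the
    homogeneous ideal of the point x of projective space, which is prime because
    the target is a domain. *)
Definition ray : {mpoly rat[n.+1]} -> {poly rat} :=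
  mmap (@polyC rat) (fun i => x i *: 'X).

HB.instance Definition _ := GRing.RMorphism.on ray.

Lemma horner_ray p t : (ray p).[t] = p.@[fun i => t * x i].
Proof.
rewrite /ray /mmap horner_sum mevalE; apply: eq_bigr => m _.
rewrite hornerM hornerC horner_prod; congr (_ * _); apply: eq_bigr => i _.
by rewrite horner_exp hornerZ hornerX mulrC.
Qed.

Lemma ray_homog p d : p \is d.-homog -> ray p = p.@[x] *: 'X^d.
Proof.
move=> /dhomogP hp; rewrite /ray /mmap mevalE scaler_suml big_seq [RHS]big_seq.
apply: eq_bigr => m /hp /= <-; rewrite /mmap1 mul_polyC -scalerA; congr (_ *: _).
rewrite mdegE -prodrXr -scaler_prod; apply: eq_bigr => i _.
by rewrite exprZn.
Qed.

Lemma point_prime : (exists i, x i != 0) -> proj_prime [set p | ray p = 0].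
Proof.
move=> [i xi]; split.
- split; rewrite /=.
  + exact: rmorph0.
  + by move=> p q p0 q0; rewrite rmorphD /= p0 q0 addr0.
  + by move=> p q q0; rewrite rmorphM /= q0 mulr0.
  + move=> p e p0; rewrite (ray_homog (pihomogP _ _ _)).
    have he : (e < msize p + e.+1)%N by rewrite addnS ltnS leq_addl.
    have := p0.
    rewrite [p in ray p](@pihomog_partitionE _ _ mdeg (msize p + e.+1) p);
      last exact: leq_addr.
    rewrite rmorph_sum /= => /(congr1 (fun q : {poly rat} => q`_e)).
    rewrite coef0 coef_sum (bigD1 (Ordinal he)) //= big1.
      rewrite (ray_homog (pihomogP _ _ _)) coefZ coefXn eqxx mulr1 addr0 => ->.
      by rewrite scale0r.
    move=> j ne; rewrite (ray_homog (pihomogP _ _ _)) coefZ coefXn.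
    case: eqP => [ej|]; last by rewrite mulr0.
    by case/eqP: ne; apply: val_inj.
- by rewrite /= rmorph1; apply/eqP/oner_neq0.
- move=> p q /=; rewrite rmorphM => /eqP; rewrite mulf_eq0.
  by case/orP => /eqP; [left|right].
- exists i; rewrite /= /ray mmapX mmap1U => /eqP.
  by rewrite scaler_eq0 (negPf xi) polyX_eq0.
Qed.
End PointIdeal.

(** Take the product of the forms given by [component_form].  The ideal of a
    rational point L contains the ideal C, hence a minimal prime over C, hence
    one of the factors. *)
Lemma curve_equation C d : pure_dim C 1 -> has_degree C d ->
  exists F : poly3, [/\ F != 0, F \is (2 * d).-homog &
    forall L : rat_proj 2, lies_on L C -> forall x, val L = <[x]>%VS ->
      F.@[fun i => x 0 i] = 0].
Proof.
move=> dimC [k [P [e [_ Pcomp eP ->]]]].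
have compP i : irreducible_component C (P i) by apply/Pcomp; exists i.
have /choice[F FP] : forall i, exists F : poly3,
    [/\ F != 0, F \is (2 * e i).-homog & P i F].
  move=> i; apply: component_form (dimC _ (compP i)) (eP i).
  by case: (compP i).
exists (\prod_i F i); split.
- by apply/prodf_neq0 => i _; case: (FP i).
- rewrite big_distrr /=; apply: (big_ind2 (fun (p : poly3) m => p \is m.-homog)).
  + exact: dhomog1.
  + by move=> *; exact: dhomogM.
  + by move=> i _; case: (FP i).
move=> L LC x Lx; pose v i := x 0 i.
have x0 : x != 0.
  apply/eqP => x0; have := valP L.
  by rewrite Lx x0 dim_vline eqxx.
have vne : exists i, v i != 0.
  apply: contrapT => /forallNP h; case/eqP: x0; apply/rowP => i; rewrite mxE.
  by apply: contrapT => /eqP; exact: h.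
(* a polynomial that vanishes at all nonzero points of L is zero along L *)
have CQ : C `<=` [set p | ray v p = 0].
  move=> p Cp /=; apply: contrapT => /eqP rp.
  have /exists_nonroot[t] : 'X * ray v p != 0 by rewrite mulf_neq0 ?polyX_eq0.
  rewrite hornerM hornerX mulf_eq0 negb_or horner_ray => /andP[t0].
  rewrite (@meval_eq _ _ _ (fun i => (t *: x) 0 i)); last by move=> i; rewrite mxE.
  rewrite LC ?eqxx //; first by rewrite Lx memvZ // memv_line.
  by rewrite scaler_eq0 negb_or t0.
have [Q [/Pcomp[i ->] PQ]] := minimal_prime (point_prime vne) CQ.
have [_ hF /PQ /= rF] := FP i.
have Fi : (F i).@[v] = 0.
  have := ray_homog v hF; rewrite rF => /(congr1 (fun q : {poly rat} => q.[1])).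
  by rewrite horner0 hornerZ hornerXn expr1n mulr1.
by rewrite rmorph_prod /= (bigD1 i) //= -/(v) Fi mul0r.
Qed.

Lemma exists_cbrt (d : nat) : (0 < d)%N ->
  exists D, [/\ (0 < D)%N, (d <= D ^ 3)%N & (D.-1 ^ 3 < d)%N].
Proof.
move=> d0; have ex : exists D, (d <= D ^ 3)%N.
  by exists d; rewrite !expnS expn0; nia.
case: (ex_minnP ex) => D hD minD; exists D.
have D0 : (0 < D)%N by move: hD; case: D {minD} => //; rewrite leqNgt d0.
split=> //; rewrite ltnNge; apply/negP => /minD.
by rewrite leqNgt prednK // leqnn.
Qed.

(** The least D with d <= D^3 exceeds the cube root of d, which is at least 1,
    by less than 1; so it is at most twice that root. *)
Lemma cbrt_powR (R : realType) (d D : nat) :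
  (0 < D)%N -> (0 < d)%N -> (D.-1 ^ 3 < d)%N ->
  (D ^ 2)%:R <= 4 * (d%:R `^ (2 / 3)) :> R.
Proof.
move=> D0 d0 Dd; pose t : R := d%:R `^ (3^-1).
have t3 : t ^+ 3 = d%:R.
  by rewrite /t -powR_mulrn ?powR_ge0 // -powRrM mulVf ?powRr1 ?ler0n // pnatr_eq0.
have t0 : 0 <= t by exact: powR_ge0.
have -> : d%:R `^ (2 / 3) = t ^+ 2.
  by rewrite /t -powR_mulrn ?powR_ge0 // -powRrM mulrC.
have D2t : D%:R <= 2 * t.
  have : D.-1%:R <= t.
    rewrite -(@ler_pXn2r _ 3) ?nnegrE ?ler0n // t3 -natrX ler_nat; exact: ltnW.
  have : 1 <= t.
    by rewrite -(@ler_pXn2r _ 3) ?nnegrE // t3 expr1n ler1n.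
  by case: D D0 {Dd} => //= D _; rewrite -(natr1 D); lra.
rewrite natrX (_ : 4 * t ^+ 2 = (2 * t) ^+ 2); last by ring.
by rewrite ler_pXn2r ?nnegrE ?ler0n ?mulr_ge0.
Qed.

Theorem corollary3p5 (R : realType) :
  exists c : R, forall (d : nat) (C : set {mpoly rat[3]}) (B : R),
    (1 <= d)%N -> curve C -> has_degree C d -> 1 <= B ->
    finite_set (rational_points C B) /\
    (#|` fset_set (rational_points C B)|%fset)%:R
      <= c * (d%:R `^ (2 / 3)) * B ^+ 2.
Proof.
(* the constants of [size_zeros_le] and [cbrt_powR] *)
exists (4000%:R * 4) => d C B d0 [_ dimC] degC B1.
have [F [F0 hF FC]] := curve_equation dimC degC.
have [D [D0 dD Dd]] := exists_cbrt d0.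
have B0 : 0 <= B by apply: le_trans B1; exact: ler01.
pose N := Num.truncn B.
have N0 : (0 < N)%N by rewrite /N truncn_gt0.
have NB : N%:R <= B by rewrite /N truncn_le.
have bound (X : {fset rat_proj 2}) : [set` X] `<=` rational_points C B ->
    (#|` X| <= 4000 * (D ^ 2 * N ^ 2))%N.
  move=> XC.
  have /choice[f fP] : forall L : rat_proj 2, exists x : 'rV[int]_3, L \in X ->
      [/\ x != 0, (ht x <= N)%N & val L = <[toQ x]>%VS].
    move=> L; have [LX|] := boolP (L \in X); last by exists 0.
    have [_ [x [x0 xB Lx]]] := XC L LX; exists x => _; split=> //.
    apply/ht_leP => i; rewrite /N truncn_ge_nat //.
    by have := xB i; rewrite -abszE.
  have XE : [seq <[toQ x]>%VS | x <- map f X] = map val X.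
    rewrite -map_comp; apply/eq_in_map => L LX /=.
    by have [_ _ ->] := fP L LX.
  rewrite -(size_map f); apply: (size_zeros_le hF F0 _ D0 N0).
  - by rewrite leq_mul2l.
  - move=> _ /mapP[L LX ->]; have [x0 xN Lx] := fP L LX; split=> //.
    by apply: (FC L) => //; have [] := XC L LX.
  - by rewrite XE map_inj_uniq ?fset_uniq //; exact: val_inj.
have fin : finite_set (rational_points C B).
  apply: contrapT => /infinite_set_fsetP/(_ (4000 * (D ^ 2 * N ^ 2)).+1%N)[X XC].
  by rewrite leqNgt ltnS bound.
split=> //.
have /bound : [set` fset_set (rational_points C B)] `<=` rational_points C B.
  by move=> L; rewrite /= in_fset_set // inE.
rewrite -(ler_nat R) => /le_trans; apply.
have /(ler_wpM2l (ler0n R 4000)) := cbrt_powR R D0 d0 Dd.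
move: (_ `^ _) => b Db; rewrite mulnA natrM natrX.
apply: ler_pM; rewrite ?ler0n ?exprn_ge0 //; first last.
  by rewrite ler_pXn2r ?nnegrE ?ler0n.
by rewrite natrM (le_trans Db) // mulrA.
Qed.
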